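(* Let $(\mathcal F_0,\mathbf a)$ be initial data for the completion problem in $\mathbb C^d$ with $\mathbf a=\mathbf a^\downarrow\in\mathbb R_{>0}^k$ and $d\le k$, let $f:[0,\infty)\to[0,\infty)$ be strictly convex, and let $\mathcal F=(\mathcal F_0,\mathcal G)\in\mathcal C_{\mathbf a}^{\rm op}(\mathcal F_0)$ be a global minimizer of $P_f$ on $\mathcal C_{\mathbf a}^{\rm op}(\mathcal F_0)$. Let $\lambda=\lambda^\uparrow(S_{\mathcal F_0})$, $\mu=\mu^\downarrow=\mu_f(\lambda,\mathbf a)=\lambda(S_{\mathcal G})$, and let $p$, $c_1>\dots>c_p>0$, $s_{\mathcal F}$, $K_j$ and $J_j$ ($j\in\{1,\dots,p\}$) be the objects associated with $\mathcal F$ in the context. Then: 1. There exist indexes $0=s_0<s_1<\cdots<s_{p-1}<s_p=s_{\mathcal F}=\max\{j\in\{1,\dots,d\}:\mu_j\ne 0\}$ such that $$K_j=J_j=\{s_{j-1}+1,\dots,s_j\}\quad\text{for } 1\le j\le p-1,$$ $$K_p=\{s_{p-1}+1,\dots,s_p\},\qquad J_p=\{s_{p-1}+1,\dots,k\}.$$ 2. $\nu_f(\lambda,\mathbf a)=\big(c_1\mathbf 1_{s_1},\,c_2\mathbf 1_{s_2-s_1},\dots,c_p\mathbf 1_{s_p-s_{p-1}},\lambda_{s_p+1},\dots,\lambda_d\big)$, where for $1\le r\le p-1$ $$c_r=\frac1{s_r-s_{r-1}}\sum_{i=s_{r-1}+1}^{s_r}(\lambda_i+a_i),$$ and also $c_r=\lambda_j+\mu_j$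 for every $j\in K_r=J_r$. 3. The constant $c_p$ is the one given by the feasible final part, that is, $$c_p=\frac{1}{s_p-s_{p-1}}\Big[\sum_{i=s_{p-1}+1}^{k}a_i+\sum_{i=s_{p-1}+1}^{s_p}\lambda_i\Big],$$ the truncated pair $(\lambda^{s_{p-1}},\mathbf a^{s_{p-1}})=\big((\lambda_{s_{p-1}+1},\dots,\lambda_d),(a_{s_{p-1}+1},\dots,a_k)\big)$ is feasible, and $\nu(\lambda^{s_{p-1}},\mathbf a^{s_{p-1}})=(c_p\mathbf 1_{s_p-s_{p-1}},\lambda_{s_p+1},\dots,\lambda_d)$.
   Context: Notation. $\mathbf 1_m\in\mathbb R^m$ is the all-ones vector; $\operatorname{tr}x=\sum_i x_i$; $x^\downarrow$ (resp. $x^\uparrow$) is the rearrangement of $x$ in decreasing (resp. increasing, i.e. non-decreasing) order. For $x,y\in\mathbb R^m$, $x\prec y$ means $\sum_{i\le j}x_i^\downarrow\le\sum_{i\le j}y_i^\downarrow$ for all $j$ and $\operatorname{tr}x=\operatorname{tr}y$; for vectors of different sizes (non-negative entries) complete with zeros. For a finite sequence $\mathcal F=\{f_i\}$ in $\mathcal H=\mathbb C^d$, $S_{\mathcal F}=\sum_i f_i\otimes f_i$ is its frame operator, where $(x\otimes y)(z)=\langle z,y\rangle x$. For a positive semidefinite $S$, $\lambda(S)=\lambda^\downarrow(S)$ (resp. $\lambda^\uparrow(S)$) is the vector of its eigenvalues with multiplicity in decreasing (resp. increasing) order. Initial data for the completion problem: a finite sequence $\mathcal F_0=\{f_i\}_{i=1}^{n_0}$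 in $\mathcal H$ and $\mathbf a=(a_i)_{i=1}^k\in\mathbb R_{>0}^k$ with $a_1\ge\dots\ge a_k$ and $d-\operatorname{rk}S_{\mathcal F_0}\le k$. Put $\mathcal C_{\mathbf a}(\mathcal F_0)=\{(\mathcal F_0,\mathcal G):\mathcal G=\{g_i\}_{i=1}^k\subset\mathcal H,\ \|g_i\|^2=a_i\ (1\le i\le k)\}$ and $\mathcal C_{\mathbf a}^{\rm op}(\mathcal F_0)=\{(\mathcal F_0,\mathcal G)\in\mathcal C_{\mathbf a}(\mathcal F_0):\lambda(S_{\mathcal F})=(\lambda^\uparrow(S_{\mathcal F_0})+\lambda^\downarrow(S_{\mathcal G}))^\downarrow\}$, where $\mathcal F=(\mathcal F_0,\mathcal G)$, $S_{\mathcal F}=S_{\mathcal F_0}+S_{\mathcal G}$. For strictly convex $f:[0,\infty)\to[0,\infty)$, $P_f(\mathcal F)=\operatorname{tr}f(S_{\mathcal F})=\sum_{i=1}^d f(\lambda_i(S_{\mathcal F}))$. Let $\Gamma_d(\mathbf a)=\{\gamma\in\mathbb R_{\ge0}^d:\gamma=\gamma^\downarrow,\ \mathbf a\prec\gamma\}$. It is known that there is a unique $\mu_f(\lambda,\mathbf a)\in\Gamma_d(\mathbf a)$ minimizing $\gamma\mapsto\sum_{i=1}^d f(\lambda_i+\gamma_i)$ on $\Gamma_d(\mathbf a)$, that $\mathcal F=(\mathcal F_0,\mathcal G)\in\mathcal C_{\mathbf a}(\mathcal F_0)$ is a global minimizer of $P_f$ on $\mathcal C_{\mathbf a}(\mathcal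 F_0)$ iff $\mathcal F\in\mathcal C^{\rm op}_{\mathbf a}(\mathcal F_0)$ and $\lambda(S_{\mathcal G})=\mu_f(\lambda,\mathbf a)$ (so the minimizers on $\mathcal C_{\mathbf a}$ and on $\mathcal C^{\rm op}_{\mathbf a}$ are the same), and one sets $\nu_f(\lambda,\mathbf a)=\lambda+\mu_f(\lambda,\mathbf a)$. Objects associated with a global minimizer $\mathcal F=(\mathcal F_0,\mathcal G)$: let $s_{\mathcal F}=\operatorname{rk}S_{\mathcal G}=\max\{i:\mu_i\ne0\}$; $W$ is the range of $S_{\mathcal G}$, which is known to reduce $S_{\mathcal F}$; $S=S_{\mathcal F}|_W$ has distinct eigenvalues $c_1>\dots>c_p>0$; $K_j=\{i\in\{1,\dots,s_{\mathcal F}\}:\lambda_i+\mu_i=c_j\}$ and $J_j=\{i\in\{1,\dots,k\}:S g_i=c_jg_i\}$. It is known that $\{K_j\}_j$ is a partition of $\{1,\dots,s_{\mathcal F}\}$ and $\{J_j\}_j$ is a partition of $\{1,\dots,k\}$. Feasibility (for $k\ge d$). For $\lambda=\lambda^\uparrow\in\mathbb R_{\ge0}^d$, $\mathbf a=\mathbf a^\downarrow\in\mathbb R_{>0}^k$, $t=\operatorname{tr}\lambda+\operatorname{tr}\mathbf a$, define $\nu(\lambda,\mathbf a)=\frac td\mathbf 1_d$ if $\lambda_d\le\frac td$; otherwise $\nu(\lambda,\mathbf a)=(c\mathbf 1_s,\lambda_{s+1},\dots,\lambda_d)$ where $s\in\{1,\dots,d-1\}$ is the unique index such that $c=\frac1s[\operatorname{tr}\mathbf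 a+\sum_{i=1}^s\lambda_i]$ satisfies $\lambda_s\le c<\lambda_{s+1}$. The pair $(\lambda,\mathbf a)$ is feasible if $\mathbf a\prec\nu(\lambda,\mathbf a)-\lambda$. The same definition is applied to truncated pairs $(\lambda^s,\mathbf a^s)$ with $\lambda^s\in\mathbb R^{d-s}$, $\mathbf a^s\in\mathbb R^{k-s}$. *)

(* Defs.v *)
From HB Require Import structures.
From mathcomp Require Import all_boot all_order all_algebra.
From mathcomp Require Import all_classical reals.
From mathcomp Require Import complex.

Set Implicit Arguments.
Unset Strict Implicit.
Unset Printing Implicit Defensive.

Import Order.TTheory GRing.Theory Num.Theory.
Local Open Scope ring_scope.
Local Open Scope sesquilinear_scope.
Local Open Scope complex_scope.

(* Conventions.  The field of scalars is R[i] with R : realType, and vectors of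
   C^d are row vectors: an operator with matrix A maps z to z *m A, so that its
   range is the row space of A and the eigenvalue, restrictmx and spectral_diag
   of the library apply as such.  Indices are 0-based: x_(i+1) is x`_i. *)

Definition sort_down (R : realType) (n : nat) (x : n.-tuple R) : n.-tuple R :=
  [tuple of sort >=%R x].

Definition sort_up (R : realType) (n : nat) (x : n.-tuple R) : n.-tuple R :=
  [tuple of sort <=%R x].

Definition vadd (R : realType) (n : nat) (x y : n.-tuple R) : n.-tuple R :=
  [tuple x`_i + y`_i | i < n].

Definition vsub (R : realType) (n : nat) (x y : n.-tuple R) : n.-tuple R :=
  [tuple x`_i - y`_i | i < n].

Definition vtr (R : realType) (x : seq R) : R := \sum_(z <- x) z.

(* The shorter of the two vectors is completed with zeros. *)
Definition majorized (R : realType) (x y : seq R) : Prop :=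
  let x' := sort >=%R (x ++ nseq (size y - size x) 0) in
  let y' := sort >=%R (y ++ nseq (size x - size y) 0) in
  (forall j : nat, (j <= size x')%N ->
     \sum_(i < j) x'`_i <= \sum_(i < j) y'`_i) /\
  vtr x = vtr y.

(* The matrix of f \otimes f : z |-> <z, f> f is f^t* *m f. *)
Definition frame_op (R : realType) (d : nat) (F : seq 'rV[R[i]]_d) :
    'M[R[i]]_d :=
  \sum_(f <- F) (f ^t* *m f).

(* Meaningful for Hermitian A, where spectral_diag lists the eigenvalues of A,
   which are real, with multiplicities. *)
Definition eig (R : realType) (d : nat) (A : 'M[R[i]]_d) : d.-tuple R :=
  [tuple complex.Re (spectral_diag A 0 i) | i < d].

Definition eig_down (R : realType) (d : nat) (A : 'M[R[i]]_d) : d.-tuple R :=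
  sort_down (eig A).

Definition eig_up (R : realType) (d : nat) (A : 'M[R[i]]_d) : d.-tuple R :=
  sort_up (eig A).

Definition initial_data (R : realType) (d n0 k : nat)
    (F0 : n0.-tuple 'rV[R[i]]_d) (a : k.-tuple R) : Prop :=
  [/\ forall i : 'I_k, 0 < a`_i,
      sorted >=%R a
    & (d - \rank (frame_op F0) <= k)%N].

(* The completion (F0, G) is represented by G. *)
Definition completion (R : realType) (d k : nat) (a : k.-tuple R)
    (G : k.-tuple 'rV[R[i]]_d) : Prop :=
  forall i : 'I_k, dotmx (tnth G i) (tnth G i) = (a`_i)%:C.

Definition op_completion (R : realType) (d n0 k : nat)
    (F0 : n0.-tuple 'rV[R[i]]_d) (a : k.-tuple R)
    (G : k.-tuple 'rV[R[i]]_d) : Prop :=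
  completion a G /\
  eig_down (frame_op (F0 ++ G)) =
    sort_down (vadd (eig_up (frame_op F0)) (eig_down (frame_op G))).

Definition nonneg_on_nneg (R : realType) (f : R -> R) : Prop :=
  forall x : R, 0 <= x -> 0 <= f x.

Definition strictly_convex_on_nneg (R : realType) (f : R -> R) : Prop :=
  forall x y t : R, 0 <= x -> 0 <= y -> x != y -> 0 < t < 1 ->
    f (t * x + (1 - t) * y) < t * f x + (1 - t) * f y.

Definition potential (R : realType) (d : nat) (f : R -> R)
    (F : seq 'rV[R[i]]_d) : R :=
  \sum_(x <- eig_down (frame_op F)) f x.

Definition op_global_min (R : realType) (d n0 k : nat) (f : R -> R)
    (F0 : n0.-tuple 'rV[R[i]]_d) (a : k.-tuple R)
    (G : k.-tuple 'rV[R[i]]_d) : Prop :=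
  op_completion F0 a G /\
  forall G' : k.-tuple 'rV[R[i]]_d, op_completion F0 a G' ->
    potential f (F0 ++ G) <= potential f (F0 ++ G').

Definition Gamma (R : realType) (d k : nat) (a : k.-tuple R)
    (g : d.-tuple R) : Prop :=
  [/\ forall i : 'I_d, 0 <= g`_i, sorted >=%R g & majorized a g].

Definition is_mu_f (R : realType) (d k : nat) (f : R -> R) (lam : d.-tuple R)
    (a : k.-tuple R) (m : d.-tuple R) : Prop :=
  Gamma a m /\
  forall g : d.-tuple R, Gamma a g ->
    \sum_(i < d) f (lam`_i + m`_i) <= \sum_(i < d) f (lam`_i + g`_i).

(* The minimizer of is_mu_f; the default value [nseq_tuple d 0] is only used
   when there is none. *)
Definition mu_f (R : realType) (d k : nat) (f : R -> R) (lam : d.-tuple R)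
    (a : k.-tuple R) : d.-tuple R :=
  xget (nseq_tuple d 0) [set m | is_mu_f f lam a m]%classic.

Definition nu_f (R : realType) (d k : nat) (f : R -> R) (lam : d.-tuple R)
    (a : k.-tuple R) : d.-tuple R :=
  vadd lam (mu_f f lam a).

(* c lists the distinct eigenvalues c_1 > ... > c_p of the restriction of S_F
   to W, the range of S_G; the row space of frame_op G is W. *)
Definition restricted_spectrum (R : realType) (d n0 k : nat)
    (F0 : n0.-tuple 'rV[R[i]]_d) (G : k.-tuple 'rV[R[i]]_d) (c : seq R) :
    Prop :=
  sorted >%R c /\
  forall z : R[i],
    eigenvalue (restrictmx (frame_op G) (frame_op (F0 ++ G))) z <->
    exists2 x : R, x \in c & z = x%:C.

Definition Kset (R : realType) (d k : nat) (lam mu : d.-tuple R)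
    (G : k.-tuple 'rV[R[i]]_d) (x : R) : {set 'I_d} :=
  [set i : 'I_d | (i < \rank (frame_op G))%N && (lam`_i + mu`_i == x)].

(* Every g_i belongs to W, so S g_i is S_F g_i. *)
Definition Jset (R : realType) (d n0 k : nat)
    (F0 : n0.-tuple 'rV[R[i]]_d) (G : k.-tuple 'rV[R[i]]_d) (x : R) :
    {set 'I_k} :=
  [set i : 'I_k | tnth G i *m frame_op (F0 ++ G) == x%:C *: tnth G i].

Definition nu_const (R : realType) (d k : nat) (lam : d.-tuple R)
    (a : k.-tuple R) (s : nat) : R :=
  s%:R^-1 * (vtr a + \sum_(i < s) lam`_i).

(* The last branch is never reached when lam is nondecreasing with
   non-negative entries, a has positive entries and 0 < d <= k. *)
Definition nu (R : realType) (d k : nat) (lam : d.-tuple R)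
    (a : k.-tuple R) : d.-tuple R :=
  let t := vtr lam + vtr a in
  if lam`_d.-1 <= t / d%:R then nseq_tuple d (t / d%:R)
  else if [pick s : 'I_d | (0 < s)%N &&
             (lam`_s.-1 <= nu_const lam a s < lam`_s)] is Some s
  then [tuple if (i < s)%N then nu_const lam a s else lam`_i | i < d]
  else lam.

Definition feasible (R : realType) (d k : nat) (lam : d.-tuple R)
    (a : k.-tuple R) : Prop :=
  majorized a (vsub (nu lam a) lam).

(* Main.v *)
Require Import Defs.
From HB Require Import structures.
From mathcomp Require Import all_boot all_order all_algebra.
From mathcomp Require Import all_classical reals.
From mathcomp Require Import complex perm.
From mathcomp Require Import zify ring lra.

Set Implicit Arguments.
Unset Strict Implicit.
Unset Printing Implicit Defensive.

Import Order.TTheory GRing.Theory Num.Theory.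
Local Open Scope ring_scope.

(** Let lam list the eigenvalues of S_F0 increasingly and mu those of S_G
    decreasingly.  The theorem comes from a finite-dimensional convex program
    and from two equality cases of matrix inequalities.

    The program.  On optimal completions the potential is the sum of
    f (lam_i + mu_i).  A Schur-Horn argument identifies the vectors mu that
    occur with Gamma_d(a): [frame_majorization] is the inequality of Schur, and
    [exists_frame] realizes any vector of Gamma_d(a) in any eigenbasis of S_F0,
    by plane rotations of the rows of a diagonal matrix
    ([prescribe_row_norms]).  So mu minimizes the sum over Gamma_d(a)
    ([op_min_is_mu_f]).

    The transfer argument.  If lam_v + mu_v < lam_u + mu_u, moving a little
    mass of mu from u to v strictly decreases the sum, so some constraint must
    forbid it.  When u ends a plateau of mu and v starts one, the order of mu
    survives a small transfer, and the only possible obstruction is an active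
    inequality among the prefix sums of a and mu between u and v
    ([transfer_tight]).  Hence lam + mu is non-increasing on the support of mu,
    each drop of lam + mu happens where the prefix sums of a and mu agree, and
    lam stays above the last level beyond the support ([minimizer_blocks],
    [support_tail]).  The sizes of the blocks of lam + mu give the indexes s_j,
    and equality of the prefix sums gives the averages c_r.

    Rigidity.  Equality of prefix sums is the equality case in Schur's
    inequality: it splits the frame G orthogonally along the eigenspaces of
    S_G ([tight_coef_eq0]).  The spectral identity defining an optimal
    completion makes the trace of S_F0 S_G equal to the sum of lam_i mu_i, the
    smallest value that the two spectra permit, and this forces eigenvectors of
    S_G in its range to be eigenvectors of S_F ([row_eigen]).  Both together
    show that each g_i is an eigenvector of S_F for the level of its block,
    which determines the sets J_j.

    The final part.  The vector nu is obtained by water filling: its entries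
    are the maxima of lam_i and a level, and the trace determines such a vector
    ([fill_level_unique]).  The last block of lam + mu, followed by the tail of
    lam, has this form, and the residual vector is the truncation of mu, which
    majorizes the truncation of a because the prefix sums agree where the two
    are cut ([truncated_nuE], [truncated_feasible]). *)

(** * Prefix sums, majorization and the transfer argument *)

Section RealPart.
Variable R : realType.
Implicit Types (x y z : seq R) (f : R -> R).

Lemma sorted_geP x :
  sorted >=%R x <-> (forall i j, (i <= j < size x)%N -> x`_j <= x`_i).
Proof.
split=> [xs i j /andP[ij jx]|H]; last by apply/(sortedP 0) => i ix; apply: H; rewrite leqnSn ix.
have tr : transitive (>=%R : rel R) by move=> b a c ba cb; exact: le_trans cb ba.
have rf : reflexive (>=%R : rel R) by move=> a; exact: lexx.
by apply: (sorted_leq_nth tr rf 0 xs) => //; rewrite unfold_in /= ?(leq_ltn_trans ij jx).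
Qed.

Lemma sorted_leP x :
  sorted <=%R x <-> (forall i j, (i <= j < size x)%N -> x`_i <= x`_j).
Proof.
split=> [xs i j /andP[ij jx]|H]; last by apply/(sortedP 0) => i ix; apply: H; rewrite leqnSn ix.
by apply: (sorted_leq_nth le_trans lexx 0 xs) => //; rewrite unfold_in /= ?(leq_ltn_trans ij jx).
Qed.

(** Entries beyond the end of a sequence read as 0, so prefix sums of vectors of
    different sizes can be compared over one index set. *)
Lemma psum_widen x n j : (size x <= n)%N ->
  \sum_(i < j) x`_i = \sum_(i < n | (i < j)%N) x`_i.
Proof.
move=> xn; case: (leqP j n) => jn; first exact: (big_ord_widen _ (fun i => x`_i)).
have -> : \sum_(i < n | (i < j)%N) x`_i = \sum_(i < n) x`_i.
  by apply: eq_bigl => i; rewrite (ltn_trans (ltn_ord i) jn).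
rewrite (big_ord_widen _ (fun i => x`_i) (ltnW jn)) [LHS](bigID (fun i : 'I_j => (i < n)%N)) /=.
rewrite [X in _ + X]big1 ?addr0 // => i; rewrite -leqNgt => ni.
by rewrite nth_default // (leq_trans xn ni).
Qed.

Lemma psum_total x j : (size x <= j)%N -> \sum_(i < j) x`_i = vtr x.
Proof.
move=> xj; rewrite /vtr (big_nth 0) big_mkord.
rewrite (psum_widen _ (leqnn (size x))); apply: eq_bigl => i.
by rewrite (leq_trans (ltn_ord i) xj).
Qed.

Lemma nth_sort_pad x n i : sorted >=%R x -> (forall i, 0 <= x`_i) ->
  (sort >=%R (x ++ nseq n 0))`_i = x`_i.
Proof.
move=> xs x0; have nthE j : (x ++ nseq n 0)`_j = x`_j.
  rewrite nth_cat nth_nseq; case: ltnP => // xj.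
  by rewrite [RHS]nth_default //; case: ifP.
rewrite sorted_sort ?nthE //; first by move=> b a c ba cb; exact: le_trans cb ba.
apply/sorted_geP => j l /andP[jl lx]; rewrite !nthE.
case: (ltnP l (size x)) => lx'; first by apply: (proj1 (sorted_geP x)) => //; lia.
by rewrite [x`_l]nth_default.
Qed.

(** Padding a non-increasing non-negative vector with zeros leaves it sorted, so
    for such vectors majorization needs no rearrangement. *)
Lemma majorized_sortedP x y :
  sorted >=%R x -> sorted >=%R y ->
  (forall i, 0 <= x`_i) -> (forall i, 0 <= y`_i) ->
  majorized x y <->
  (forall j, \sum_(i < j) x`_i <= \sum_(i < j) y`_i) /\ vtr x = vtr y.
Proof.
move=> xs ys x0 y0; rewrite /majorized.
split=> -[H e]; split=> // j; last first.
  move=> _; under eq_bigr do rewrite nth_sort_pad //.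
  by under [X in _ <= X]eq_bigr do rewrite nth_sort_pad //.
case: (leqP j (maxn (size x) (size y))) => jm; last first.
  have /andP[xj yj] : (size x <= j)%N && (size y <= j)%N by rewrite -geq_max ltnW.
  by rewrite !psum_total ?e.
have := H j; under eq_bigr do rewrite nth_sort_pad //.
under [X in _ <= X]eq_bigr do rewrite nth_sort_pad //.
by apply; rewrite size_sort size_cat size_nseq -maxnE.
Qed.

Lemma nth_ge0 n (x : n.-tuple R) :
  (forall i : 'I_n, 0 <= x`_i) -> forall i, 0 <= x`_i.
Proof.
move=> H i; case: (ltnP i n) => ix; first exact: (H (Ordinal ix)).
by rewrite nth_default // size_tuple.
Qed.

Lemma GammaE d k (a : k.-tuple R) (g : d.-tuple R) :
  sorted >=%R a -> (forall i, 0 <= a`_i) ->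
  Gamma a g <->
  [/\ forall i, 0 <= g`_i, forall i j, (i <= j < d)%N -> g`_j <= g`_i,
      forall j, \sum_(i < j) a`_i <= \sum_(i < j) g`_i & vtr a = vtr g].
Proof.
move=> as_ a0; have E := @sorted_geP g; rewrite size_tuple in E; split.
  case=> /nth_ge0 g0 gs /(majorized_sortedP as_ gs a0 g0)[H e]; split=> //.
  exact: (proj1 E).
case=> g0 /E gs H e; split=> //; apply/(majorized_sortedP as_ gs a0 g0); by split.
Qed.

(** Both u - e and v + e lie strictly between v and u, and they divide the
    segment in complementary ratios: add the two convexity inequalities. *)
Lemma convex_transfer f u v e : strictly_convex_on_nneg f ->
  0 <= v -> 0 < e -> e < u - v -> f (u - e) + f (v + e) < f u + f v.
Proof.
move=> cf v0 e0 euv; have uv : 0 < u - v by lra.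
pose t := e / (u - v).
have te : t * (u - v) = e by rewrite /t divfK //; lra.
have t01 : 0 < t < 1 by rewrite /t divr_gt0 //= ltr_pdivrMr // mul1r.
have nuv : u != v by apply/eqP => E; lra.
have u0 : 0 <= u by lra.
have := cf u v t u0 v0 nuv t01.
have -> : t * u + (1 - t) * v = v + e by rewrite -te; ring.
rewrite eq_sym in nuv; have := cf v u t v0 u0 nuv t01.
have -> : t * v + (1 - t) * u = u - e by rewrite -te; ring.
lra.
Qed.

Lemma pos_lower_bound x : all (fun t : R => 0 < t) x ->
  exists2 e, 0 < e & forall t : R, t \in x -> e <= t.
Proof.
elim: x => [_|b x IH /= /andP[b0 /IH[e e0 H]]]; first by exists 1.
exists (Num.min b e); first by rewrite lt_min b0.
by move=> t; rewrite inE => /orP[/eqP->|/H et]; rewrite ge_min ?lexx // et orbT.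
Qed.

Definition transfer n (g : n.-tuple R) u v (e : R) : n.-tuple R :=
  [tuple g`_i - e *+ (i == u :> nat) + e *+ (i == v :> nat) | i < n].

Lemma nth_mktuple n (F : nat -> R) i : (i < n)%N ->
  [tuple F i | i < n]`_i = F i.
Proof.
by move=> ix; rewrite -(tnth_nth 0 _ (Ordinal ix)) tnth_mktuple.
Qed.

Lemma nth_transfer n (g : n.-tuple R) u v e i : (u < n)%N -> (v < n)%N ->
  (transfer g u v e)`_i = g`_i - e *+ (i == u) + e *+ (i == v).
Proof.
move=> un vn; case: (ltnP i n) => ix.
  by rewrite /transfer (nth_mktuple (fun i => g`_i - e *+ (i == u) + e *+ (i == v))).
rewrite !nth_default ?size_tuple //.
have [-> ->] : (i == u) = false /\ (i == v) = false by lia.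
by rewrite subr0 addr0.
Qed.

Lemma sum_indic j u (e : R) : \sum_(i < j) e *+ (i == u :> nat) = e *+ (u < j)%N.
Proof.
case: ltnP => uj.
  rewrite (bigD1 (Ordinal uj)) //= eqxx mulr1n big1 ?addr0 // => i.
  by rewrite -val_eqE /= => /negbTE ->.
rewrite big1 // => i _; have ij := ltn_ord i.
by have -> : (i == u :> nat) = false by lia.
Qed.

Lemma psum_transfer n (g : n.-tuple R) u v e j : (u < n)%N -> (v < n)%N ->
  \sum_(i < j) (transfer g u v e)`_i =
  \sum_(i < j) g`_i - e *+ (u < j)%N + e *+ (v < j)%N.
Proof.
move=> un vn; under eq_bigr do rewrite nth_transfer //.
by rewrite big_split sumrB /= !sum_indic.
Qed.

Lemma vtrE n (g : n.-tuple R) : vtr g = \sum_(i < n) g`_i.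
Proof. by rewrite psum_total // size_tuple. Qed.

Section Minimizer.
Variables (d k : nat) (f : R -> R) (lam mu : d.-tuple R) (a : k.-tuple R).
Hypotheses (cf : strictly_convex_on_nneg f).
Hypotheses (lam0 : forall i, 0 <= lam`_i).
Hypotheses (lam_up : forall i j, (i <= j < d)%N -> lam`_i <= lam`_j).
Hypotheses (a_down : sorted >=%R a) (a0 : forall i, 0 <= a`_i).
Hypothesis (min_mu : is_mu_f f lam a mu).

Let psum_le j : \sum_(i < j) a`_i <= \sum_(i < j) mu`_i.
Proof. by case: min_mu => /(GammaE _ a_down a0)[]. Qed.

(** The amount e is at most half of every gap of mu, and at most every slack of a
    prefix constraint, that the transfer can consume; if no prefix constraint
    between u and v is active, the transferred vector is admissible and better
    than the minimizer.  For v < u no prefix sum decreases, so the conclusion is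
    then absurd and the situation cannot occur. *)
Lemma transfer_tight u v : (u < d)%N -> (v < d)%N ->
  lam`_v + mu`_v < lam`_u + mu`_u -> 0 < mu`_u ->
  (forall j, (u < j < d)%N -> mu`_j < mu`_u) ->
  (forall i, (i < v)%N -> mu`_v < mu`_i) ->
  exists2 l, (u < l <= v)%N & \sum_(i < l) a`_i = \sum_(i < l) mu`_i.
Proof.
move=> ud vd xuv mu_u last_u first_v; apply: contrapT => notight.
case: min_mu => Gmu minmu.
have [mu0 mu_down _ mu_tr] := proj1 (GammaE _ a_down a0) Gmu.
have slack l : (u < l <= v)%N -> 0 < \sum_(i < l) mu`_i - \sum_(i < l) a`_i.
  move=> ulv; rewrite subr_gt0 lt_neqAle psum_le andbT; apply/eqP => E.
  by apply: notight; exists l.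
pose S := [:: mu`_u; (lam`_u + mu`_u - (lam`_v + mu`_v)) / 2] ++
  [seq (mu`_u - mu`_j) / 2 | j <- iota u.+1 (d - u.+1)] ++
  [seq (mu`_i - mu`_v) / 2 | i <- iota 0 v] ++
  [seq \sum_(i < l) mu`_i - \sum_(i < l) a`_i | l <- iota u.+1 (v - u)].
have [e e0 eS] : exists2 e, 0 < e & forall t : R, t \in S -> e <= t.
  apply: pos_lower_bound; rewrite !all_cat /= mu_u !all_map /=.
  apply/and4P; split; first by lra.
  - apply/allP => j; rewrite mem_iota /= => jj.
    have /last_u : (u < j < d)%N by lia.
    by lra.
  - by apply/allP => j; rewrite mem_iota /= => /first_v jj; lra.
  - by apply/allP => j; rewrite mem_iota /= => jj; apply: slack; lia.
have e1 : e <= mu`_u by apply: eS; rewrite mem_head.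
have e2 : e <= (lam`_u + mu`_u - (lam`_v + mu`_v)) / 2.
  by apply: eS; rewrite !inE eqxx orbT.
have e3 j : (u < j < d)%N -> e <= (mu`_u - mu`_j) / 2.
  move=> uj; apply: eS; rewrite !mem_cat; apply/orP; right; apply/orP; left.
  by apply/mapP; exists j => //; rewrite mem_iota; lia.
have e4 i : (i < v)%N -> e <= (mu`_i - mu`_v) / 2.
  move=> uj; apply: eS; rewrite !mem_cat; apply/orP; right; apply/orP; right.
  by apply/orP; left; apply/mapP; exists i => //; rewrite mem_iota; lia.
have e5 l : (u < l <= v)%N -> e <= \sum_(i < l) mu`_i - \sum_(i < l) a`_i.
  move=> uj; apply: eS; rewrite !mem_cat; apply/orP; right; apply/orP; right.
  by apply/orP; right; apply/mapP; exists l => //; rewrite mem_iota; lia.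
have nuv : (u == v) = false by apply/eqP => E; move: xuv; rewrite E ltxx.
pose g := transfer mu u v e.
have gE i : g`_i = mu`_i - e *+ (i == u) + e *+ (i == v) by apply: nth_transfer.
have Gg : Gamma a g.
  apply/(GammaE _ a_down a0); split.
  - move=> i; rewrite gE; case: (i =P u) => [->|_]; first by rewrite nuv /=; lra.
    by rewrite subr0 addr_ge0 // mulrn_wge0 // ltW.
  - move=> i j /andP[ij jd]; rewrite !gE.
    case: (ltngtP i j) ij => // [ij _|-> //].
    have mij : mu`_j <= mu`_i by apply: mu_down; lia.
    case: (i =P u) => [Ei|_].
      have := e3 j; rewrite -Ei ij jd => /(_ isT).
      by case: (j =P i) => [?|_]; [lia|]; case: (i == v); case: (j == v) => /=; lra.
    case: (j =P v) => [Ej|_].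
      have := e4 i; rewrite -Ej ij => /(_ isT).
      by case: (i =P j) => [?|_]; [lia|]; case: (j == u) => /=; lra.
    by case: (i == v); case: (j == u) => /=; lra.
  - move=> l; rewrite psum_transfer //; have := psum_le l; have := e5 l.
    case: (ltnP u l) => ul /=; case: (ltnP v l) => vl /=; lra.
  - rewrite mu_tr vtrE [RHS]vtrE psum_transfer // ud vd /=; lra.
have := minmu _ Gg; apply/negP; rewrite -ltNge.
rewrite (bigD1 (Ordinal ud)) //= (bigD1 (Ordinal vd)) /=; last first.
  by rewrite -val_eqE /= eq_sym nuv.
rewrite [X in _ < X](bigD1 (Ordinal ud)) //= [X in _ < _ + X](bigD1 (Ordinal vd)) /=; last first.
  by rewrite -val_eqE /= eq_sym nuv.
rewrite !addrA; apply: ltr_leD; last first.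
  apply: ler_sum => i /andP[]; rewrite -!val_eqE /= => /negbTE iu /negbTE iv.
  by rewrite gE iu iv subr0 addr0.
rewrite !gE !eqxx nuv eq_sym nuv /= !mulr1n !mulr0n addr0 subr0 !addrA.
apply: convex_transfer => //; last by lra.
by apply: addr_ge0.
Qed.

Let mu_down i j : (i <= j < d)%N -> mu`_j <= mu`_i.
Proof. by case: min_mu => /(GammaE _ a_down a0)[_ H _ _] _; apply: H. Qed.

Lemma plateau_last i : (i < d)%N -> exists u, [/\ (i <= u < d)%N, mu`_u = mu`_i
  & forall j, (u < j < d)%N -> mu`_j < mu`_u].
Proof.
move=> id; pose P u := (u < d)%N && (mu`_u == mu`_i).
have exP : exists u, P u by exists i; rewrite /P id eqxx.
have bP u : P u -> (u <= d)%N by case/andP => /ltnW.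
case: (ex_maxnP exP bP) => u /andP[ud /eqP mu_u] maxu.
exists u; split=> //; first by rewrite ud andbT maxu // /P id eqxx.
move=> j /andP[uj jd]; rewrite lt_neqAle mu_down ?(ltnW uj) // andbT.
apply/eqP => E; suff : (j <= u)%N by rewrite leqNgt uj.
by apply: maxu; rewrite /P jd E mu_u eqxx.
Qed.

Lemma plateau_first i : (i < d)%N -> exists v, [/\ (v <= i)%N, mu`_v = mu`_i
  & forall j, (j < v)%N -> mu`_v < mu`_j].
Proof.
move=> id; pose P u := (mu`_u == mu`_i).
have exP : exists u, P u by exists i; rewrite /P eqxx.
case: (ex_minnP exP) => v /eqP mu_v minv.
have vi : (v <= i)%N by apply: minv; rewrite /P.
exists v; split=> //.
move=> j jv; rewrite lt_neqAle mu_down ?andbT; last by rewrite (ltnW jv); lia.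
apply/eqP => E; suff : (v <= j)%N by rewrite leqNgt jv.
by apply: minv; rewrite /P -E mu_v.
Qed.

(** Otherwise mass could be moved from the end of the plateau of j to the start
    of the plateau of i, which only raises prefix sums of mu. *)
Lemma minimizer_mono i j : (i < j < d)%N -> 0 < mu`_j ->
  lam`_j + mu`_j <= lam`_i + mu`_i.
Proof.
move=> /andP[ij jd] muj; rewrite leNgt; apply/negP => xij.
have [u [/andP[ju ud] mu_u last_u]] := plateau_last jd.
have [v [vi mu_v first_v]] := plateau_first (ltn_trans ij jd).
have l1 : lam`_j <= lam`_u by apply: lam_up; lia.
have l2 : lam`_v <= lam`_i by apply: lam_up; lia.
have vd : (v < d)%N by lia.
have xvu : lam`_v + mu`_v < lam`_u + mu`_u by rewrite mu_u mu_v; lra.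
have muu : 0 < mu`_u by rewrite mu_u.
by have [l] := transfer_tight ud vd xvu muu last_u first_v; lia.
Qed.

(** The transfer is made from the end of the plateau of i to the start of the
    plateau of j; since lam increases, these indexes still compare strictly. *)
Lemma minimizer_tight i j : (i < j < d)%N ->
  lam`_j + mu`_j < lam`_i + mu`_i ->
  exists2 l, (i < l <= j)%N & \sum_(i < l) a`_i = \sum_(i < l) mu`_i.
Proof.
move=> /andP[ij jd] xij; have id := ltn_trans ij jd.
have [u [/andP[iu ud] mu_u last_u]] := plateau_last id.
have [v [vj mu_v first_v]] := plateau_first jd.
have l1 : lam`_i <= lam`_u by apply: lam_up; lia.
have l2 : lam`_v <= lam`_j by apply: lam_up; lia.
have l3 : lam`_i <= lam`_j by apply: lam_up; lia.
have m0 : 0 <= mu`_j by case: min_mu => /(GammaE _ a_down a0)[H _ _ _] _; apply: H.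
have vd : (v < d)%N by lia.
have xvu : lam`_v + mu`_v < lam`_u + mu`_u by rewrite mu_u mu_v; lra.
have muu : 0 < mu`_u by rewrite mu_u; lra.
have [l ll E] := transfer_tight ud vd xvu muu last_u first_v.
by exists l => //; lia.
Qed.

(** Gamma is convex and f strictly convex: the midpoint of two distinct
    minimizers would do better than both. *)
Lemma mu_fE : mu_f f lam a = mu.
Proof.
apply: xget_unique => // m [Gm minm]; apply: contrapT => nm.
case: min_mu => Gmu minmu.
have [m0 md mp mt] := proj1 (GammaE _ a_down a0) Gm.
have [u0 ud up ut] := proj1 (GammaE _ a_down a0) Gmu.
pose h : d.-tuple R := [tuple (m`_i + mu`_i) / 2 | i < d].
have hE i : h`_i = (m`_i + mu`_i) / 2.
  case: (ltnP i d) => id; first by rewrite (nth_mktuple (fun i => (m`_i + mu`_i) / 2)).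
  by rewrite !nth_default ?size_tuple // addr0 mul0r.
have hp j : \sum_(i < j) h`_i = (\sum_(i < j) m`_i + \sum_(i < j) mu`_i) / 2.
  by rewrite -big_split mulr_suml; apply: eq_bigr => i _; rewrite hE.
have Gh : Gamma a h.
  apply/(GammaE _ a_down a0); split.
  - by move=> i; rewrite hE; have := m0 i; have := u0 i; lra.
  - by move=> i j ij; rewrite !hE; have := md i j ij; have := ud i j ij; lra.
  - by move=> j; rewrite hp; have := mp j; have := up j; lra.
  - by rewrite [RHS]vtrE hp -!vtrE; lra.
have half : 2^-1 = 1 - 2^-1 :> R by lra.
have t01 : 0 < (2^-1 : R) < 1 by lra.
have step (i : 'I_d) : m`_i != mu`_i ->
    f (lam`_i + h`_i) < (f (lam`_i + m`_i) + f (lam`_i + mu`_i)) / 2.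
  move=> ni.
  have nx : lam`_i + m`_i != lam`_i + mu`_i by rewrite (inj_eq (addrI _)).
  have := @cf _ _ _ (addr_ge0 (lam0 i) (m0 i)) (addr_ge0 (lam0 i) (u0 i)) nx t01.
  rewrite -half.
  have -> : 2^-1 * (lam`_i + m`_i) + 2^-1 * (lam`_i + mu`_i) = lam`_i + h`_i.
    by rewrite hE; field.
  lra.
have [i ni] : exists i : 'I_d, m`_i != mu`_i.
  apply: contrapT => H; apply: nm; apply: eq_from_tnth => i.
  rewrite !(tnth_nth 0); apply/eqP; apply: contrapT => /negP E; by apply: H; exists i.
have : \sum_(i < d) f (lam`_i + h`_i) <
    \sum_(i < d) (f (lam`_i + m`_i) + f (lam`_i + mu`_i)) / 2.
  rewrite (bigD1 i) //= [X in _ < X](bigD1 i) //= ltr_leD ?step //.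
  apply: ler_sum => j _; case: (eqVneq m`_j mu`_j) => [E|/step/ltW //].
  have hm : h`_j = mu`_j by rewrite hE E; field.
  by rewrite hm E; lra.
rewrite -mulr_suml big_split /=.
have := minmu _ Gh; have := minm _ Gh; lra.
Qed.

End Minimizer.
End RealPart.

(** * Water filling and blocks of constancy *)

Section Levels.
Variable R : realType.

(** The level c fills the first m places: the entries of lam submerged by c come
    first, and the volume of water is the trace of a. *)
Definition water_level d k (lam : d.-tuple R) (a : k.-tuple R) m (c : R) :=
  [/\ (0 < m <= d)%N, forall i, (i < m)%N -> lam`_i <= c,
      forall i, (m <= i < d)%N -> c <= lam`_i &
      m%:R * c = vtr a + \sum_(i < m) lam`_i].

Definition fill_level d (lam : d.-tuple R) m (c : R) : d.-tuple R :=
  [tuple if (i < m)%N then c else lam`_i | i < d].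

Lemma fill_level_max d k (lam : d.-tuple R) (a : k.-tuple R) m c (i : 'I_d) :
  water_level lam a m c -> tnth (fill_level lam m c) i = Num.max c lam`_i.
Proof.
case=> _ lo hi _; rewrite tnth_mktuple; case: ltnP => im.
  by rewrite max_l // lo.
by rewrite max_r // hi // im ltn_ord.
Qed.

Lemma sum_fill_level d k (lam : d.-tuple R) (a : k.-tuple R) m c :
  water_level lam a m c -> \sum_i tnth (fill_level lam m c) i = vtr a + vtr lam.
Proof.
case=> /andP[_ md] _ _ E.
under eq_bigr do rewrite tnth_mktuple.
rewrite (bigID (fun i : 'I_d => (i < m)%N)) /=.
under eq_bigr => i im do rewrite im.
rewrite sumr_const.
have -> : #|[pred i : 'I_d | (i < m)%N]| = m.
  by rewrite -sum1_card -(big_ord_widen _ (fun=> 1%N) md) sum1_card card_ord.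
under [X in _ + X]eq_bigr => i /negbTE im do rewrite im.
rewrite -mulr_natl E -addrA; congr (_ + _).
rewrite vtrE [RHS](bigID (fun i : 'I_d => (i < m)%N)) /=; congr (_ + _).
exact: (big_ord_widen _ (fun i => lam`_i)).
Qed.

(** Two levels are comparable, hence so are the filled vectors entrywise; they
    have the same trace, so they coincide.  The pairs (m, c) themselves may
    differ, when entries of lam are equal to the level. *)
Lemma fill_level_unique d k (lam : d.-tuple R) (a : k.-tuple R) m c m' c' :
  water_level lam a m c -> water_level lam a m' c' ->
  fill_level lam m c = fill_level lam m' c'.
Proof.
wlog cc : m c m' c' / c <= c'.
  by move=> W H H'; case: (leP c c') => [cc|/ltW cc]; [exact: W|rewrite -(W m' c' m c)].
move=> H H'; apply: eq_from_tnth => i; apply/eqP; rewrite eq_sym -subr_eq0; apply/eqP.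
have ge0 (j : 'I_d) : true -> 0 <= tnth (fill_level lam m' c') j - tnth (fill_level lam m c) j.
  rewrite subr_ge0 (fill_level_max _ H) (fill_level_max _ H') => _.
  by rewrite ge_max le_max cc /= le_max lexx orbT.
apply: (psumr_eq0P ge0) => //.
by rewrite sumrB (sum_fill_level H) (sum_fill_level H') subrr.
Qed.

(** Each branch of the definition of nu produces a filled vector, so uniqueness
    applies; the last branch is excluded because the largest index n up to which
    lam stays below c would be an admissible choice. *)
Lemma nu_fill_level d k (lam : d.-tuple R) (a : k.-tuple R) m c :
  (forall i j, (i <= j < d)%N -> lam`_i <= lam`_j) ->
  water_level lam a m c -> nu lam a = fill_level lam m c.
Proof.
move=> lam_up H; have [/andP[m0 md] lo hi E] := H.
have d0 : (0 < d)%N by lia.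
have dR : 0 < d%:R :> R by rewrite ltr0n.
have full x : d%:R * x = vtr a + vtr lam -> (forall i, (i < d)%N -> lam`_i <= x) ->
    water_level lam a d x.
  by move=> Ex Hx; split=> //; [rewrite d0 leqnn|move=> i; rewrite leqNgt andNb|rewrite Ex (vtrE lam)].
rewrite /nu; set t := vtr lam + vtr a.
have [ht|ht] := leP lam`_d.-1 (t / d%:R).
  have -> : nseq_tuple d (t / d%:R) = fill_level lam d (t / d%:R).
    by apply: eq_from_tnth => i; rewrite tnth_mktuple ltn_ord tnth_nseq.
  apply: fill_level_unique H; apply: full => [|i id].
    by rewrite /t; field; rewrite lt0r_neq0.
  by apply: le_trans ht; apply: lam_up; lia.
case: pickP => [s /and3P[s0 lo' hi']|none].
  apply: (@fill_level_unique _ k lam a s _ m c _ H); split.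
  - by rewrite s0 ltnW.
  - by move=> i si; apply: le_trans lo'; apply: lam_up; have := ltn_ord s; lia.
  - by move=> i si; apply: le_trans (ltW hi') _; apply: lam_up; lia.
  - by rewrite /nu_const mulrA divff ?mul1r // pnatr_eq0 -lt0n.
pose P n := (m <= n <= d)%N && [forall i : 'I_d, (i < n)%N ==> (lam`_i <= c)].
have exP : exists n, P n.
  by exists m; rewrite /P leqnn md; apply/forallP => i; apply/implyP; apply: lo.
have bP n : P n -> (n <= d)%N by case/andP => /andP[].
case: (ex_maxnP exP bP) => n /andP[/andP[mn nd] /forallP lon] maxn.
have lo' i : (i < n)%N -> lam`_i <= c.
  by move=> ni; have := lon (Ordinal (leq_trans ni nd)); rewrite /= ni.
have lamc i : (m <= i < n)%N -> lam`_i = c.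
  move=> mi; apply/eqP; rewrite eq_le lo' ?hi //; lia.
have nc : n%:R * c = vtr a + \sum_(i < n) lam`_i.
  have -> : \sum_(i < n) lam`_i = \sum_(i < m) lam`_i + (n - m)%:R * c.
    rewrite -!(big_mkord xpredT (fun i => lam`_i)) (@big_cat_nat _ _ _ m) //=.
    congr (_ + _); rewrite big_nat (eq_bigr (fun=> c)) // -big_nat.
    by rewrite sumr_const_nat mulr_natl.
  by rewrite addrA -E natrB //; ring.
have {}nd : (n < d)%N.
  rewrite ltn_neqAle nd andbT; apply/eqP => nE; move: ht; apply/negP; rewrite -leNgt.
  have -> : t / d%:R = c.
    rewrite nE in nc; rewrite /t [X in X / _]addrC (vtrE lam) -nc mulrC mulKf //.
    exact: lt0r_neq0.
  by apply: lo'; lia.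
have n0 : (0 < n)%N by lia.
have nE : nu_const lam a n = c by rewrite /nu_const -nc mulKf // pnatr_eq0; lia.
have := none (Ordinal nd); rewrite /= n0 nE lo' /=; last by lia.
move/negbT; rewrite -leNgt => lamn.
suff : (n.+1 <= n)%N by rewrite ltnn.
apply: maxn; rewrite /P nd (leq_trans mn) //=; apply/forallP => i; apply/implyP.
by rewrite ltnS => ni; apply: le_trans lamn; apply: lam_up; rewrite ni nd.
Qed.

Lemma initial_segment (P : pred nat) r :
  (forall i j, (i <= j < r)%N -> P j -> P i) ->
  exists n, forall i, (i < n)%N = (i < r)%N && P i.
Proof.
elim: r => [|r IH] H; first by exists 0%N.
have [|n Hn] := IH; first by move=> i j ij; apply: H; lia.
case Pr : (P r); last first.
  exists n => i; rewrite Hn ltnS [in RHS]leq_eqVlt; case: eqP => [->|//].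
  by rewrite ltnn Pr.
exists r.+1 => i; case: ltnP => //= ir; symmetry; apply: H Pr; lia.
Qed.

Lemma sorted_gt_nth (c : seq R) : sorted >%R c ->
  forall i j, (i < j < size c)%N -> c`_j < c`_i.
Proof.
move=> cs i j /andP[ij jp].
have tr : transitive (>%R : rel R) by move=> b u v bu vb; exact: lt_trans vb bu.
by apply: (sorted_ltn_nth tr 0 cs) => //; rewrite unfold_in /= ?(ltn_trans ij jp).
Qed.

Lemma last_block_index p (s : nat -> nat) i : (0 < p)%N -> s 0%N = 0%N ->
  exists2 j, (j < p)%N & (s j <= i)%N && ((j.+1 < p)%N ==> (i < s j.+1)%N).
Proof.
move=> p_gt0 s0; pose P j := (j < p)%N && (s j <= i)%N.
have exP : exists j, P j by exists 0%N; rewrite /P p_gt0 s0.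
have bP j : P j -> (j <= p)%N by case/andP => /ltnW.
case: (ex_maxnP exP bP) => j /andP[jp sj] maxj; exists j => //.
rewrite sj /=; apply/implyP => jp'; rewrite ltnNge; apply/negP => sji.
by have := maxj j.+1; rewrite /P jp' sji ltnn => /(_ isT).
Qed.

(** The index s j counts the entries with a level above c_j, and all of them
    when j = p; since x decreases these entries form an initial segment. *)
Lemma level_blocks p r (c : p.-tuple R) (x : nat -> R) :
  sorted >%R c -> (forall i j, (i <= j < r)%N -> x j <= x i) ->
  (forall i, (i < r)%N -> x i \in (c : seq R)) ->
  (forall j, (j < p)%N -> exists2 i, (i < r)%N & x i = c`_j) ->
  exists s : nat -> nat, [/\ s 0%N = 0%N,
    forall j, (j < p)%N -> (s j < s j.+1)%N, s p = r &
    forall j i, (j < p)%N ->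
      (s j <= i < s j.+1)%N = (i < r)%N && (x i == c`_j)].
Proof.
move=> cs xd xc cx.
have cE := sorted_gt_nth cs; rewrite size_tuple in cE.
have xE i : (i < r)%N -> exists2 l, (l < p)%N & x i = c`_l.
  by move/xc => /(nthP 0)[l]; rewrite size_tuple => lp <-; exists l.
have /choice[s sE] : forall j, exists n, forall i,
    (i < n)%N = (i < r)%N && ((p <= j)%N || (c`_j < x i)).
  move=> j; apply: initial_segment => i l il; case: (p <= j)%N => //=.
  by move=> /lt_le_trans; apply; apply: xd.
have cI j l : (j < p)%N -> (l < p)%N -> (c`_j < c`_l) = (l < j)%N.
  move=> jp lp; case: (ltngtP l j) => [lj|jl|->]; last by rewrite ltxx.
    by rewrite cE // lj.
  by apply/negbTE; rewrite -leNgt ltW // cE // jl.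
exists s; split.
- apply/eqP; rewrite -leqn0 leqNgt sE; apply/negP => /andP[r0].
  have [l lp xl] := xE _ r0; rewrite leqNgt (leq_ltn_trans _ lp) //= xl.
  by rewrite cI ?(leq_ltn_trans _ lp).
- move=> j jp; have [i ir xi] := cx j jp.
  have : ~~ (i < s j)%N by rewrite sE ir leqNgt jp xi ltxx.
  rewrite -leqNgt => H; apply: leq_ltn_trans H _; rewrite sE ir /=.
  by case: leqP => //= jp'; rewrite xi cE // ltnSn.
- apply/eqP; rewrite eqn_leq; apply/andP; split; rewrite leqNgt.
    by rewrite sE ltnn.
  by have := sE p (s p); rewrite ltnn leqnn /= andbT => <-.
move=> j i jp; rewrite leqNgt !sE; case: (ltnP i r) => //= ir.
have [l lp xl] := xE _ ir; rewrite xl leqNgt jp /= cI // -leqNgt.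
have -> : ((p <= j.+1)%N || (c`_j.+1 < c`_l)) = (l <= j)%N.
  by case: (leqP p j.+1) => jp' /=; [apply/esym; lia|rewrite cI].
rewrite -eqn_leq; apply/eqP/eqP => [-> //|clj].
by apply/eqP; rewrite eqn_leq leqNgt -cI // clj ltxx /= leqNgt -cI // clj ltxx.
Qed.
End Levels.

(** * Prescribing the norms of the rows of a matrix *)

Section Rotations.
Variable R : rcfType.

(** A binary quadratic form that takes values of opposite signs on the two axes
    has an isotropic direction; it is normalized here. *)
Lemma isotropic_direction (x y z : R) : 0 <= x -> z <= 0 ->
  exists u v : R, u ^+ 2 + v ^+ 2 = 1 /\ x * u ^+ 2 + y * (u * v) *+ 2 + z * v ^+ 2 = 0.
Proof.
move=> x0 z0; have [->|xn] := eqVneq x 0.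
  by exists 1, 0; split; ring.
pose w := (- y + Num.sqrt (y ^+ 2 - x * z)) / x.
have D0 : 0 <= y ^+ 2 - x * z.
  by rewrite addr_ge0 ?sqr_ge0 // oppr_ge0 mulr_ge0_le0.
have Dw : (x * w + y) ^+ 2 = y ^+ 2 - x * z.
  rewrite -[RHS]sqr_sqrtr //; congr (_ ^+ 2); rewrite /w; field; exact: xn.
have wq : x * w ^+ 2 + y * w *+ 2 + z = 0.
  apply: (mulfI xn); rewrite mulr0; move: Dw => /eqP; rewrite -subr_eq0 => /eqP <-.
  ring.
(* The value w makes (w, 1) isotropic; only its equation is used below. *)
clearbody w; have N0 : 0 < w ^+ 2 + 1 by rewrite ltr_wpDl ?sqr_ge0.
pose N := Num.sqrt (w ^+ 2 + 1).
have N2 : N ^+ 2 = w ^+ 2 + 1 by rewrite sqr_sqrtr // ltW.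
have Nn : N != 0 by rewrite -sqrf_eq0 N2 lt0r_neq0.
clearbody N.
exists (w / N), (1 / N); split.
  by rewrite !expr_div_n expr1n N2; field; exact: lt0r_neq0.
rewrite !expr_div_n mulf_div -expr2 expr1n !mulr1.
have -> : x * (w ^+ 2 / N ^+ 2) + y * (w / N ^+ 2) *+ 2 + z * (1 / N ^+ 2) =
  (x * w ^+ 2 + y * w *+ 2 + z) / N ^+ 2 by field.
by rewrite wq mul0r.
Qed.

Definition sqnorm_row k d (T : 'M[R]_(k, d)) i : R := \sum_l T i l ^+ 2.

(** Rotating rows i and j in their plane preserves the Gram matrix of the
    columns.  The required angle is an isotropic direction of the difference
    between the squared norm of u T_i + v T_j and t (u^2 + v^2). *)
Lemma rotate_rows k d (T : 'M[R]_(k, d)) (i j : 'I_k) (t : R) : i != j ->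
  sqnorm_row T j <= t <= sqnorm_row T i ->
  exists T' : 'M[R]_(k, d), [/\ T'^T *m T' = T^T *m T, sqnorm_row T' i = t,
    sqnorm_row T' j = sqnorm_row T i + sqnorm_row T j - t &
    forall l, l != i -> l != j -> sqnorm_row T' l = sqnorm_row T l].
Proof.
move=> ij /andP[jt ti]; have ji : j != i by rewrite eq_sym.
pose b := \sum_l T i l * T j l.
have [u [v [uv1 uvq]]] : exists u v : R, u ^+ 2 + v ^+ 2 = 1 /\
    (sqnorm_row T i - t) * u ^+ 2 + b * (u * v) *+ 2 +
    (sqnorm_row T j - t) * v ^+ 2 = 0.
  by apply: isotropic_direction; rewrite ?subr_ge0 ?subr_le0.
pose T' := \matrix_(l < k, m < d) if l == i then u * T i m + v * T j m
  else if l == j then u * T j m - v * T i m else T l m.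
have sq x y : \sum_l (x * T i l + y * T j l) ^+ 2 =
    x ^+ 2 * sqnorm_row T i + b * (x * y) *+ 2 + y ^+ 2 * sqnorm_row T j.
  rewrite /sqnorm_row /b -mulrnAr mulr_suml !mulr_sumr -!big_split /=.
  by apply: eq_bigr => l _; ring.
have Ti : sqnorm_row T' i = t.
  rewrite /sqnorm_row; under eq_bigr do rewrite mxE eqxx.
  rewrite sq -[RHS]mul1r -uv1; apply/eqP; rewrite -subr_eq0 -uvq; apply/eqP; ring.
exists T'; split=> //.
- apply/matrixP => m m'; rewrite !mxE (bigD1 i) // (bigD1 j) //= !mxE.
  rewrite [RHS](bigD1 i) // [X in _ = _ + X](bigD1 j) //= !mxE !addrA.
  rewrite (negbTE ji) !eqxx; congr (_ + _).
    rewrite -[RHS]mul1r -uv1; ring.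
  by apply: eq_bigr => l /andP[li lj]; rewrite !mxE (negbTE li) (negbTE lj).
- have Tj : sqnorm_row T' j = \sum_l (- v * T i l + u * T j l) ^+ 2.
    rewrite /sqnorm_row; apply: eq_bigr => l _; rewrite mxE (negbTE ji) eqxx.
    by congr (_ ^+ 2); ring.
  have : sqnorm_row T' i = \sum_l (u * T i l + v * T j l) ^+ 2.
    by apply: eq_bigr => l _; rewrite mxE eqxx.
  rewrite Tj Ti !sq => {1}->.
  rewrite -[X in X + _ - _]mul1r -[X in _ + X - _]mul1r -uv1; ring.
move=> l li lj; apply: eq_bigr => m _.
by rewrite mxE (negbTE li) (negbTE lj).
Qed.

(** Induction on the number of rows with a wrong norm.  The first such row i
    is too long, because prefix sums dominate; let j be the first row that is
    too short.  Moving the smaller of the excess of i and the deficit of j from i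
    to j corrects one of the two rows, and keeps the prefix sums dominating
    since no row before j is too short.  The transfer is a rotation because a_j
    is at most a_i, so that the new norms lie between the old ones. *)
Lemma prescribe_row_norms k d (T : 'M[R]_(k, d)) (a : 'I_k -> R) :
  (forall i j : 'I_k, (i <= j)%N -> a j <= a i) ->
  (forall m, 0 <= \sum_(i < k | (i < m)%N) (sqnorm_row T i - a i)) ->
  \sum_i (sqnorm_row T i - a i) = 0 ->
  exists T' : 'M[R]_(k, d), T'^T *m T' = T^T *m T /\
    forall i, sqnorm_row T' i = a i.
Proof.
move=> a_down.
have [n] := ubnP #|[pred i | sqnorm_row T i != a i]|.
elim: n => // n IH in T *; rewrite ltnS => card_n pre tot.
case: (pickP (fun i => sqnorm_row T i != a i)) => [i0 i0P|none]; last first.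
  by exists T; split=> // i; apply/eqP/negPn; rewrite none.
pose e i := sqnorm_row T i - a i.
have [i iP mini] : exists2 i : 'I_k, e i != 0 & forall l : 'I_k, (l < i)%N -> e l = 0.
  have i0P' : e i0 != 0 by rewrite subr_eq0.
  case: (@arg_minnP _ i0 (fun i => e i != 0) val i0P') => i iP mini; exists i => // l li.
  by apply/eqP/negPn; apply/negP => /mini; rewrite leqNgt li.
have sum_first (m : 'I_k) : \sum_(l < k | (l < m.+1)%N) e l =
    e m + \sum_(l < k | (l < m)%N) e l.
  rewrite (bigD1 m) //=; congr (_ + _); apply: eq_bigl => l.
  by rewrite ltnS [RHS]ltn_neqAle andbC -val_eqE.
have ei : 0 < e i.
  rewrite lt_neqAle eq_sym iP /=; have := pre i.+1; rewrite (sum_first i).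
  by rewrite big1 ?addr0 // => l /mini.
have [j jP minj] : exists2 j : 'I_k, e j < 0 & forall l : 'I_k, (l < j)%N -> 0 <= e l.
  have [j0 j0P] : exists j0, e j0 < 0.
    apply: contrapT => H; have ge0 l : 0 <= e l.
      by rewrite leNgt; apply/negP => el; apply: H; exists l.
    have E0 : e i = 0 by rewrite (psumr_eq0P (fun l _ => ge0 l) tot).
    by move: ei; rewrite E0 ltxx.
  case: (@arg_minnP _ j0 (fun j => e j < 0) val j0P) => j jP minj; exists j => // l lj.
  by rewrite leNgt; apply/negP => /minj; rewrite leqNgt lj.
have ij : (i < j)%N.
  rewrite ltnNge leq_eqVlt; apply/negP => /orP[/eqP/val_inj E|/mini E].
    by move: jP ei; rewrite E => /lt_trans H /H; rewrite ltxx.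
  by move: jP; rewrite E ltxx.
have nij : i != j by rewrite -val_eqE /= ltn_eqF.
have nji : j != i by rewrite eq_sym.
pose D := Num.min (e i) (- e j).
have Di : D <= e i by rewrite ge_min lexx.
have Dj : D <= - e j by rewrite ge_min lexx orbT.
have D0 : 0 < D by rewrite lt_min ei oppr_gt0.
have aij := a_down i j (ltnW ij).
have [|T' [TT Ti Tj Tl]] := @rotate_rows k d T i j (sqnorm_row T i - D) nij.
  by move: Di Dj D0; rewrite /e => *; apply/andP; split; lra.
have eE l : sqnorm_row T' l - a l = e l - D *+ (l == i) + D *+ (l == j).
  rewrite /e; have [->|li] := eqVneq l i.
    by rewrite Ti (negbTE nij) /=; ring.
  have [->|lj] := eqVneq l j; first by rewrite Tj /=; ring.
  by rewrite Tl //=; ring.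
have pick1 (P : pred 'I_k) (l : 'I_k) : \sum_(m | P m) D *+ (m == l) = D *+ P l.
  rewrite (bigID (fun m => m == l)) /= [X in _ + X]big1 => [|m /andP[_ /negbTE->] //].
  rewrite addr0; case Pl : (P l).
    rewrite (big_pred1 l) ?eqxx // => m; rewrite /= andbC.
    by case: eqP => // ->.
  by rewrite big_pred0 // => m; case: eqP => [->|]; rewrite ?andbF ?Pl.
have {IH}[|||T'' [TT'' H]] := IH T'.
- apply: leq_trans card_n; apply: proper_card; apply/properP; split.
    apply/fintype.subsetP => l; rewrite !inE -subr_eq0 eE.
    have [->|li] := eqVneq l i; first by move=> _; rewrite -subr_eq0.
    have [->|lj] := eqVneq l j; first by move=> _; rewrite -subr_eq0 lt_eqF.
    by rewrite subr0 addr0 subr_eq0.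
  have [ed|ed] := leP (e i) (- e j).
    exists i; rewrite !inE ?negbK -subr_eq0 // eE eqxx (negbTE nij).
    by rewrite /D min_l //=; apply/eqP; ring.
  exists j; rewrite !inE ?negbK -subr_eq0; first by rewrite (lt_eqF jP).
  rewrite eE eqxx (negbTE nji).
  by rewrite /D min_r ?ltW //=; apply/eqP; ring.
- move=> m; under eq_bigr do rewrite eE.
  rewrite big_split sumrB /= !pick1; have := pre m; rewrite -/e.
  case: (ltnP i m) => im; case: (ltnP j m) => jm /=; try lra.
  move=> _; rewrite addr0 subr_ge0; apply: le_trans Di _.
  rewrite (bigD1 i) //= lerDl sumr_ge0 // => l /andP[lm _].
  by apply: minj; apply: leq_trans lm jm.
- by under eq_bigr do rewrite eE; rewrite big_split sumrB /= !pick1 tot; ring.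
by exists T''; rewrite TT''.
Qed.
End Rotations.

(** * Unitary diagonalization and traces *)

Section Spectral.
Local Open Scope sesquilinear_scope.
Local Open Scope complex_scope.
Variable R : realType.
Local Notation C := R[i].

(** The squared modulus as an element of the real field, where the order is
    total. *)
Definition sqmod (z : C) : R := complex.Re z ^+ 2 + complex.Im z ^+ 2.

Lemma sqmodE (z : C) : (sqmod z)%:C = z * Num.conj z.
Proof. by rewrite /sqmod add_Re2_Im2 normCK. Qed.

Lemma sqmod_ge0 z : 0 <= sqmod z.
Proof. by rewrite addr_ge0 ?sqr_ge0. Qed.

Lemma sqmod_eq0 z : sqmod z = 0 -> z = 0.
Proof.
by move/(congr1 (real_complex R)); rewrite sqmodE => /eqP; rewrite mul_conjC_eq0 => /eqP.
Qed.

Lemma conj_realc (x : R) : Num.conj (x%:C : C) = x%:C.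
Proof. by apply: (CrealP _); apply/complex_realP; exists x. Qed.

Definition diagC d (x : d.-tuple R) : 'M[C]_d := diag_mx (\row_i (x`_i)%:C).

Lemma diagC_adj d (x : d.-tuple R) : (diagC x)^t* = diagC x.
Proof.
rewrite /diagC tr_diag_mx map_diag_mx; congr diag_mx.
by apply/rowP => i; rewrite !mxE; exact: conj_realc.
Qed.

Lemma hermE d (A : 'M[C]_d) : (A \is hermsymmx) = (A == A^t*).
Proof. by rewrite qualifE /= expr0 scale1r. Qed.

Lemma adjM m n p (A : 'M[C]_(m, n)) (B : 'M[C]_(n, p)) :
  (A *m B)^t* = B^t* *m A^t*.
Proof. by rewrite trmx_mul map_mxM. Qed.

Lemma adjK m n (A : 'M[C]_(m, n)) : A^t*^t* = A.
Proof. exact: trmxCK. Qed.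

Lemma unitary_adjK d (U : 'M[C]_d) : U \is unitarymx -> U^t* *m U = 1%:M.
Proof. by move=> Uu; rewrite -invmx_unitary // mulVmx // unitarymx_unit. Qed.

Lemma adj_unitary d (U : 'M[C]_d) : U \is unitarymx -> U^t* \is unitarymx.
Proof. by move=> Uu; apply/unitarymxP; rewrite adjK; apply: unitary_adjK. Qed.

Lemma conj_diag_herm d (U : 'M[C]_d) (x : d.-tuple R) :
  U^t* *m diagC x *m U \is hermsymmx.
Proof. by rewrite hermE !adjM diagC_adj adjK mulmxA. Qed.

Lemma eig_spectral d (A : 'M[C]_d) : A \is hermsymmx ->
  exists2 U : 'M[C]_d, U \is unitarymx & A = U^t* *m diagC (eig A) *m U.
Proof.
move=> Ah; exists (spectralmx A); first exact: spectral_unitarymx.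
have -> : diagC (eig A) = diag_mx (spectral_diag A).
  congr diag_mx; apply/rowP => i; rewrite mxE -tnth_nth tnth_mktuple RRe_real //.
  exact: (mxOverP (hermitian_spectral_diag_real Ah)).
rewrite -(invmx_unitary (spectral_unitarymx A)).
exact/orthomx_spectralP/hermitian_normalmx.
Qed.

Lemma conj_diag_entry d n (U : 'M[C]_(d, n)) (x : d.-tuple R) a b :
  (U^t* *m diagC x *m U) a b = \sum_i Num.conj (U i a) * (x`_i)%:C * U i b.
Proof.
by rewrite mxE; apply: eq_bigr => i _; rewrite mul_mx_diag !mxE.
Qed.

(** The eigenvalues can be listed in any order, by permuting the rows of the
    unitary matrix. *)
Lemma spectral_perm d (A : 'M[C]_d) (x : d.-tuple R) :
  A \is hermsymmx -> perm_eq x (eig A) ->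
  exists2 U : 'M[C]_d, U \is unitarymx & A = U^t* *m diagC x *m U.
Proof.
move=> /eig_spectral[U Uu AE] /tuple_permP[p px].
exists (row_perm p U).
  apply/row_unitarymxP => i j.
  have /row_unitarymxP H := Uu.
  have rE l : row l (row_perm p U) = row (p l) U by apply/rowP => m; rewrite !mxE.
  by rewrite !rE H (inj_eq perm_inj).
rewrite {1}AE; apply/matrixP => a b; rewrite !conj_diag_entry.
rewrite (reindex_inj (@perm_inj _ p)); apply: eq_bigr => i _; rewrite !mxE.
by rewrite px -(tnth_nth 0 [tuple tnth (eig A) (p i) | i < d] i) tnth_mktuple (tnth_nth 0).
Qed.

Lemma char_poly_conj d (U A : 'M[C]_d) : U \is unitarymx ->
  char_poly (U^t* *m A *m U) = char_poly A.
Proof.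
move=> Uu; rewrite /char_poly /char_poly_mx !map_mxM.
have UU : map_mx polyC (U^t*) *m map_mx polyC U = 1%:M.
  by rewrite -map_mxM unitary_adjK // map_mx1.
have -> : 'X%:M - map_mx polyC (U^t*) *m map_mx polyC A *m map_mx polyC U =
    map_mx polyC (U^t*) *m ('X%:M - map_mx polyC A) *m map_mx polyC U.
  by rewrite mulmxBr mulmxBl scalar_mxC -(mulmxA 'X%:M) UU mulmx1.
by rewrite !det_mulmx mulrAC -det_mulmx UU det1 mul1r.
Qed.

Lemma char_poly_diagC d (x : d.-tuple R) :
  char_poly (diagC x) = \prod_(z <- [seq t%:C | t <- x]) ('X - z%:P).
Proof.
rewrite char_poly_trig ?diag_mx_is_trig // big_map big_tuple.
by apply: eq_bigr => i _; rewrite !mxE eqxx mulr1n -tnth_nth.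
Qed.

(** Both lists of eigenvalues give the roots of the characteristic polynomial. *)
Lemma eig_conj_diag d (U : 'M[C]_d) (x : d.-tuple R) : U \is unitarymx ->
  perm_eq (eig (U^t* *m diagC x *m U)) x.
Proof.
move=> Uu; set A := _ *m U; have Ah : A \is hermsymmx := conj_diag_herm U x.
have [V Vu AE] := eig_spectral Ah.
have : char_poly A = char_poly A by [].
rewrite {1}AE /A !char_poly_conj // !char_poly_diagC => /prod_XsubC_eq.
by move/(perm_map (@complex.Re R)); rewrite !(@mapK _ _ (real_complex R) (@complex.Re R)).
Qed.

Lemma trace_conj_diag d (U A : 'M[C]_d) : U \is unitarymx ->
  \tr (U^t* *m A *m U) = \tr A.
Proof. by move=> Uu; rewrite mxtrace_mulC mulmxA (unitarymxP Uu) mul1mx. Qed.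

Lemma trace_sq d (U : 'M[C]_d) (x : d.-tuple R) (A := U^t* *m diagC x *m U) :
  U \is unitarymx -> \tr (A *m A) = (\sum_(i < d) x`_i ^+ 2)%:C.
Proof.
move=> Uu; have -> : A *m A = U^t* *m (diagC x *m diagC x) *m U.
  by rewrite /A !mulmxA mulmxtVK.
rewrite trace_conj_diag // /diagC mulmx_diag mxtrace_diag rmorph_sum.
by apply: eq_bigr => i _; rewrite !mxE rmorphXn.
Qed.

(** The squared moduli of the entries of U V^* form the doubly stochastic array
    of the equality case in [rearrangement_equality]. *)
Lemma trace_mul d (U V : 'M[C]_d) (x y : d.-tuple R) (W := U *m V^t*) :
  \tr ((U^t* *m diagC x *m U) *m (V^t* *m diagC y *m V)) =
  (\sum_(i < d) \sum_(j < d) x`_i * y`_j * sqmod (W i j))%:C.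
Proof.
rewrite -!mulmxA mxtrace_mulC !mulmxA -(mulmxA _ U) -/W.
rewrite -(mulmxA _ V) -[V *m U^t*]adjK adjM adjK -/W.
rewrite rmorph_sum; apply: eq_bigr => i _.
rewrite /diagC mxE rmorph_sum; apply: eq_bigr => j _.
rewrite mul_mx_diag mul_diag_mx !mxE !rmorphM /= sqmodE.
by rewrite -!mulrA; congr (_ * _); rewrite mulrCA.
Qed.
End Spectral.

(** * Two rigidity statements for real arrays *)

Section Rearrangement.
Variables (R : realType) (d : nat) (lam mu : d.-tuple R).
Hypothesis lam_up : forall i j, (i <= j < d)%N -> lam`_i <= lam`_j.
Hypothesis mu_down : forall i j, (i <= j < d)%N -> mu`_j <= mu`_i.

(** The averages of consecutive entries of lam make the dual prices symmetric
    enough for [gap] to detect equality on both sides of the diagonal. *)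
Definition price_step l : R := (lam`_l + lam`_l.+1) / 2 * (mu`_l.+1 - mu`_l).
Definition dual_price j : R := \sum_(l < j) price_step l.
(** The reduced cost of pairing lam_i with mu_j in the transport problem whose
    optimal plan is the diagonal: lam_i mu_j minus dual prices of i and j. *)
Definition gap i j : R :=
  lam`_i * (mu`_j - mu`_i) - (dual_price j - dual_price i).

Lemma gapS i j : gap i j.+1 =
  gap i j + (lam`_i - (lam`_j + lam`_j.+1) / 2) * (mu`_j.+1 - mu`_j).
Proof. by rewrite /gap /dual_price big_ord_recr /= /price_step; ring. Qed.

(** The cost of pairing lam_i with mu_j is then the one of a diagonal pair. *)
Definition matched i j := exists2 l, (l < d)%N & lam`_l = lam`_i /\ mu`_l = mu`_j.

Lemma gap_diag i : gap i i = 0.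
Proof. by rewrite /gap; ring. Qed.

(** Away from the diagonal the gap grows by non-negative increments.  A zero
    increment means that mu is constant on the step, or that lam is constant
    from i up to it: in both cases a matching index can be carried along. *)
Lemma gap_right i n : (i + n < d)%N ->
  0 <= gap i (i + n) /\ (gap i (i + n) = 0 -> matched i (i + n)).
Proof.
elim: n => [|n IH] id.
  by rewrite addn0 in id *; rewrite gap_diag; split=> // _; exists i.
have [g0 gm] := IH ltac:(lia).
rewrite addnS gapS; rewrite addnS in id; set j := (i + n)%N in id g0 gm *.
have l1 : lam`_i <= lam`_j by apply: lam_up; rewrite /j; lia.
have l2 : lam`_j <= lam`_j.+1 by apply: lam_up; lia.
have m1 : mu`_j.+1 <= mu`_j by apply: mu_down; lia.
have t0 : 0 <= (lam`_i - (lam`_j + lam`_j.+1) / 2) * (mu`_j.+1 - mu`_j).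
  by apply: mulr_le0; lra.
split=> [|E]; first exact: addr_ge0.
have [l ld [Ll Lm]] := gm ltac:(lra).
have : (lam`_i - (lam`_j + lam`_j.+1) / 2) * (mu`_j.+1 - mu`_j) == 0 by apply/eqP; lra.
rewrite mulf_eq0 => /orP[/eqP H|/eqP H]; last by exists l => //; split=> //; lra.
by exists j.+1 => //; split=> //; lra.
Qed.

Lemma gap_left i n : (n <= i < d)%N ->
  0 <= gap i (i - n) /\ (gap i (i - n) = 0 -> matched i (i - n)).
Proof.
elim: n => [|n IH] /andP[ni id].
  by rewrite subn0 gap_diag; split=> // _; exists i.
have [g0 gm] := IH ltac:(lia).
have jE : (i - n = (i - n.+1).+1)%N by lia.
have jd : ((i - n.+1).+1 <= i)%N by lia.
move: g0 gm; rewrite jE gapS; set j := (i - n.+1)%N in jd *; move=> g0 gm.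
have l1 : lam`_j.+1 <= lam`_i by apply: lam_up; lia.
have l2 : lam`_j <= lam`_j.+1 by apply: lam_up; lia.
have m1 : mu`_j.+1 <= mu`_j by apply: mu_down; lia.
have t0 : (lam`_i - (lam`_j + lam`_j.+1) / 2) * (mu`_j.+1 - mu`_j) <= 0.
  by apply: mulr_ge0_le0; lra.
split=> [|E]; first by lra.
have : (lam`_i - (lam`_j + lam`_j.+1) / 2) * (mu`_j.+1 - mu`_j) == 0 by apply/eqP; lra.
have [l ld [Ll Lm]] := gm ltac:(lra).
rewrite mulf_eq0 => /orP[/eqP H|/eqP H]; last by exists l => //; split=> //; lra.
by exists j; [lia|split=> //; lra].
Qed.

Lemma gap_matched i j : (i < d)%N -> (j < d)%N ->
  0 <= gap i j /\ (gap i j = 0 -> matched i j).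
Proof.
move=> id jd; case: (leqP i j) => ij.
  by have := @gap_right i (j - i); rewrite subnKC //; apply.
by have := @gap_left i (i - j); rewrite subKn ?(ltnW ij) //; apply; lia.
Qed.

(** Complementary slackness: the rows and columns of D sum to 1, so the D-weighted
    sum of the gaps is the difference of the two sides of the equality, which
    is 0, while all its terms are non-negative. *)
Lemma rearrangement_equality (D : 'I_d -> 'I_d -> R) :
  (forall i j, 0 <= D i j) -> (forall i, \sum_j D i j = 1) ->
  (forall j, \sum_i D i j = 1) ->
  \sum_(i < d) \sum_(j < d) lam`_i * mu`_j * D i j = \sum_(i < d) lam`_i * mu`_i ->
  forall i j, D i j != 0 -> matched i j.
Proof.
move=> D0 row1 col1 E i j Dij.
have [g0 gm] := gap_matched (ltn_ord i) (ltn_ord j); apply: gm.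
have Dg0 (a b : 'I_d) : 0 <= D a b * gap a b.
  by apply: mulr_ge0 => //; case: (gap_matched (ltn_ord a) (ltn_ord b)).
have tot : \sum_(a < d) \sum_(b < d) D a b * gap a b = 0.
  have -> : \sum_(a < d) \sum_(b < d) D a b * gap a b =
      \sum_(a < d) \sum_(b < d) lam`_a * mu`_b * D a b
      - \sum_(a < d) (lam`_a * mu`_a - dual_price a) * \sum_(b < d) D a b
      - \sum_(a < d) \sum_(b < d) dual_price b * D a b.
    rewrite -!sumrB; apply: eq_bigr => a _; rewrite mulr_sumr -!sumrB.
    by apply: eq_bigr => b _; rewrite /gap; ring.
  rewrite E [X in _ - X]exchange_big /=.
  under [X in _ - X]eq_bigr do rewrite -mulr_sumr col1 mulr1.
  under [X in _ - X - _]eq_bigr do rewrite row1 mulr1.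
  by rewrite sumrB; ring.
have := psumr_eq0P (fun a _ => sumr_ge0 _ (fun b _ => Dg0 a b)) tot.
move=> /(_ i isT) /(psumr_eq0P (fun b _ => Dg0 i b)) /(_ j isT) /eqP.
by rewrite mulf_eq0 (negbTE Dij) /= => /eqP.
Qed.
End Rearrangement.

Section Substochastic.
Variables (R : realType) (d k : nat) (mu : d.-tuple R) (D : 'I_k -> 'I_d -> R).
Hypothesis mu0 : forall i, 0 <= mu`_i.
Hypothesis mu_down : forall i j, (i <= j < d)%N -> mu`_j <= mu`_i.
Hypothesis D0 : forall i l, 0 <= D i l.
Hypothesis col_le1 : forall l, \sum_i D i l <= 1.
Hypothesis row_le1 : forall i, \sum_l D i l <= 1.

Let theta s l := \sum_(i < k | (i < s)%N) D i l.

Let theta_le1 s l : theta s l <= 1.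
Proof.
apply: le_trans (col_le1 l); rewrite [leRHS](bigID (fun i : 'I_k => (i < s)%N)) /=.
by rewrite lerDl sumr_ge0.
Qed.

Let sum_theta s : \sum_l theta s l <= s%:R.
Proof.
rewrite exchange_big /=; apply: le_trans (_ : \sum_(i < k | (i < s)%N) 1 <= _).
  exact: ler_sum.
rewrite sumr_const ler_nat; case: (leqP s k) => sk.
  by rewrite -sum1_card -(big_ord_widen _ (fun=> 1%N) sk) sum1_card card_ord.
by apply: leq_trans (max_card _) _; rewrite card_ord ltnW.
Qed.

Let weight s := \sum_(i < k | (i < s)%N) \sum_(l < d) D i l * mu`_l.

(** Summation by parts relative to the value of mu at s - 1: both parts are
    non-negative, so each vanishes when the prefix sum is attained. *)
Let deficit s : (0 < s <= d)%N -> 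
  \sum_(l < s) mu`_l - weight s =
  \sum_(l < d) (mu`_l - mu`_s.-1) * ((l < s)%N%:R - theta s l)
  + mu`_s.-1 * (s%:R - \sum_l theta s l).
Proof.
move=> /andP[s0 sd].
have -> : weight s = \sum_(l < d) mu`_l * theta s l.
  rewrite /weight exchange_big; apply: eq_bigr => l _; rewrite mulr_sumr.
  by apply: eq_bigr => i _; rewrite mulrC.
have -> : \sum_(l < s) mu`_l = \sum_(l < d) mu`_l * (l < s)%N%:R.
  rewrite (big_ord_widen _ (fun l => mu`_l) sd) big_mkcond; apply: eq_bigr => l _.
  by case: ifP; rewrite ?mulr1 ?mulr0.
have {1}-> : s%:R = \sum_(l < d) (l < s)%N%:R :> R.
  rewrite -[s in LHS]card_ord -sum1_card natr_sum (big_ord_widen _ (fun=> 1) sd).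
  by rewrite big_mkcond; apply: eq_bigr => l _; case: ifP.
rewrite -!sumrB mulr_sumr -big_split; apply: eq_bigr => l _ /=; ring.
Qed.

Let deficit_term_ge0 s (l : 'I_d) : (0 < s <= d)%N ->
  0 <= (mu`_l - mu`_s.-1) * ((l < s)%N%:R - theta s l).
Proof.
move=> /andP[s0 sd]; case: (ltnP l s) => ls /=.
  by rewrite mulr_ge0 // subr_ge0 //; apply: mu_down; lia.
rewrite sub0r mulr_le0 // ?oppr_le0 ?sumr_ge0 // subr_le0.
by apply: mu_down; have := ltn_ord l; lia.
Qed.

Lemma substochastic_psum s : (0 < s <= d)%N ->
  \sum_(i < k | (i < s)%N) \sum_(l < d) D i l * mu`_l <= \sum_(l < s) mu`_l.
Proof.
move=> sd; rewrite -subr_ge0 deficit // addr_ge0 ?sumr_ge0 // => [l _|].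
  exact: deficit_term_ge0.
by rewrite mulr_ge0 // subr_ge0.
Qed.

(** The array splits into two diagonal blocks at s.  When the deficit vanishes
    and mu drops at s, the first s rows carry no mass beyond column s, and the
    total mass s then exhausts the first s columns. *)
Lemma substochastic_tight s : (0 < s < d)%N -> mu`_s < mu`_s.-1 ->
  \sum_(i < k | (i < s)%N) \sum_(l < d) D i l * mu`_l = \sum_(l < s) mu`_l ->
  forall (i : 'I_k) (l : 'I_d), (i < s)%N != (l < s)%N -> D i l = 0.
Proof.
move=> /andP[s0 sd] mus E.
have sd' : (0 < s <= d)%N by rewrite s0 ltnW.
have term0 l := @deficit_term_ge0 s l sd'.
have mass0 : 0 <= mu`_s.-1 * (s%:R - \sum_l theta s l) by rewrite mulr_ge0 // subr_ge0.
have S0 := sumr_ge0 (index_enum 'I_d) (fun l _ => term0 l) (P := xpredT).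
have := deficit sd'; rewrite /weight E subrr => /esym/eqP.
rewrite paddr_eq0 // => /andP[/eqP T0 M0].
have {}T0 l := psumr_eq0P (fun l _ => term0 l) T0 (i := l) isT.
have mus0 : 0 < mu`_s.-1 by apply: le_lt_trans mus.
have {M0} totE : \sum_l theta s l = s%:R.
  by move: M0; rewrite mulf_eq0 (gt_eqF mus0) subr_eq0 => /eqP.
have out0 (l : 'I_d) : (s <= l)%N -> theta s l = 0.
  move=> sl; have := T0 l; rewrite ltnNge sl /= sub0r => /eqP; rewrite mulf_eq0 oppr_eq0.
  rewrite subr_eq0 lt_eqF ?orFb => [/eqP //|].
  by apply: le_lt_trans mus; apply: mu_down; rewrite sl ltn_ord.
have in1 (l : 'I_d) : (l < s)%N -> theta s l = 1.
  have : \sum_(l < d | (l < s)%N) (1 - theta s l) = 0.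
    rewrite sumrB; apply/eqP; rewrite subr_eq0; apply/eqP.
    have -> : \sum_(l < d | (l < s)%N) theta s l = s%:R.
      rewrite -totE [RHS](bigID (fun l : 'I_d => (l < s)%N)) /=.
      by rewrite [X in _ + X]big1 ?addr0 // => i; rewrite -leqNgt; apply: out0.
    rewrite -(big_ord_widen _ (fun=> 1) (ltnW sd)).
    by rewrite sumr_const card_ord.
  move=> H ls; have := psumr_eq0P _ H (i := l) ls => H1.
  by apply/eqP; rewrite eq_sym -subr_eq0; apply/eqP/H1 => i _; rewrite subr_ge0.
move=> i l; case: (ltnP i s) => is_; case: (ltnP l s) => ls // _.
  exact: (psumr_eq0P (fun i _ => D0 i l) (out0 l ls)).
have : \sum_(i < k | ~~ (i < s)%N) D i l <= 0.
  have := col_le1 l; rewrite (bigID (fun i : 'I_k => (i < s)%N)) /= -/(theta s l) in1 //.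
  by lra.
move=> H; have {}H : \sum_(i < k | ~~ (i < s)%N) D i l = 0.
  by apply/eqP; rewrite eq_le H sumr_ge0.
by apply: (psumr_eq0P (fun i _ => D0 i l) H); rewrite -leqNgt.
Qed.
End Substochastic.

(** * Coefficients of a frame in an eigenbasis of its frame operator *)

Section Frames.
Local Open Scope sesquilinear_scope.
Local Open Scope complex_scope.
Variable R : realType.
Local Notation C := R[i].

Definition frame_mx k d (G : k.-tuple 'rV[C]_d) : 'M[C]_(k, d) :=
  \matrix_(i < k) tnth G i.

Lemma row_frame_mx k d (G : k.-tuple 'rV[C]_d) i : row i (frame_mx G) = tnth G i.
Proof. by rewrite rowK. Qed.

Lemma frame_opE k d (G : k.-tuple 'rV[C]_d) :
  frame_op G = (frame_mx G)^t* *m frame_mx G.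
Proof.
rewrite /frame_op big_tuple; apply/matrixP => a b; rewrite summxE mxE.
by apply: eq_bigr => i _; rewrite !mxE big_ord1 !mxE.
Qed.

Lemma frame_op_cat d (F F' : seq 'rV[C]_d) :
  frame_op (F ++ F') = frame_op F + frame_op F'.
Proof. by rewrite /frame_op big_cat. Qed.

Lemma frame_op_herm k d (G : k.-tuple 'rV[C]_d) : frame_op G \is hermsymmx.
Proof. by rewrite hermE frame_opE adjM adjK. Qed.

Lemma dotmx_row k d (T : 'M[C]_(k, d)) i :
  dotmx (row i T) (row i T) = (\sum_l sqmod (T i l))%:C.
Proof.
rewrite dotmxE mxE rmorph_sum; apply: eq_bigr => l _.
by rewrite !mxE; symmetry; exact: sqmodE.
Qed.

Section Coefficients.
Variables (k d : nat) (G : k.-tuple 'rV[C]_d) (V : 'M[C]_d) (mu : d.-tuple R).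
Hypothesis Vu : V \is unitarymx.
Hypothesis GE : frame_op G = V^t* *m diagC mu *m V.

(** The entry (i, l) is the inner product of g_i with the l-th eigenvector of the
    frame operator. *)
Definition coef : 'M[C]_(k, d) := frame_mx G *m V^t*.

Lemma frame_mx_coef : frame_mx G = coef *m V.
Proof. by rewrite /coef -mulmxA unitary_adjK // mulmx1. Qed.

Lemma coef_gram : coef^t* *m coef = diagC mu.
Proof.
rewrite /coef adjM adjK mulmxA -(mulmxA V) -frame_opE GE !mulmxA.
by rewrite (unitarymxP Vu) mul1mx mulmxtVK.
Qed.

Lemma coef_col l : \sum_i sqmod (coef i l) = mu`_l.
Proof.
have /matrixP/(_ l l) := coef_gram; rewrite !mxE eqxx mulr1n => E.
apply: (@complexI R); rewrite -E rmorph_sum; apply: eq_bigr => i _.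
by rewrite !mxE mulrC; exact: sqmodE.
Qed.

Lemma coef_row (a : k.-tuple R) i : completion a G ->
  \sum_l sqmod (coef i l) = a`_i.
Proof.
move=> /(_ i); rewrite -row_frame_mx dotmxE => H; apply: (@complexI R).
rewrite -H -dotmx_row dotmxE /coef row_mul adjM adjK mulmxA.
by rewrite -(mulmxA (row i _)) unitary_adjK // mulmx1.
Qed.

(** An eigenvalue of the frame operator is a sum of squared moduli of
    coefficients. *)
Lemma frame_eig_ge0 i : 0 <= mu`_i.
Proof.
case: (ltnP i d) => id; last by rewrite nth_default // size_tuple.
by rewrite -(coef_col (Ordinal id)) sumr_ge0 // => l _; apply: sqmod_ge0.
Qed.

(** These ratios form the doubly substochastic array that maps mu to the vector
    of squared norms; columns with mu_l = 0 have ratio 0. *)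
Definition coef_ratio i l : R := sqmod (coef i l) / mu`_l.

Lemma coef_ratio_ge0 i l : 0 <= coef_ratio i l.
Proof. by rewrite divr_ge0 ?sqmod_ge0 ?frame_eig_ge0. Qed.

Lemma coef_eq0 i (l : 'I_d) : mu`_l = 0 -> coef i l = 0.
Proof.
rewrite -coef_col => H; apply: sqmod_eq0.
by rewrite (psumr_eq0P (fun i _ => sqmod_ge0 _) H).
Qed.

Lemma coef_ratioK i (l : 'I_d) : coef_ratio i l * mu`_l = sqmod (coef i l).
Proof.
have [m0|mn] := eqVneq mu`_l 0; last by rewrite divfK.
rewrite m0 mulr0 coef_eq0 //; by rewrite /sqmod /= expr0n addr0.
Qed.

Lemma coef_ratio_col l : \sum_i coef_ratio i l <= 1.
Proof.
rewrite -mulr_suml coef_col; have [->|mn] := eqVneq mu`_l 0.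
  by rewrite mul0r ler01.
by rewrite divff.
Qed.

(** Bessel's inequality.  The matrix P below is the orthogonal projection onto
    the range of the analysis operator; its diagonal entries q satisfy q^2 <= q. *)
Lemma coef_ratio_row i : \sum_l coef_ratio i l <= 1.
Proof.
(* M is the pseudo-inverse of the diagonal matrix: 0^-1 is 0. *)
pose M : 'M[C]_d := diag_mx (\row_l (mu`_l)^-1%:C).
have MM : M *m diagC mu *m M = M.
  rewrite /M /diagC !mulmx_diag; congr diag_mx; apply/rowP => l; rewrite !mxE -!rmorphM /=.
  have [->|mn] := eqVneq mu`_l 0; first by rewrite invr0 mulr0.
  by rewrite mulVf // mul1r.
have Mh : M^t* = M.
  rewrite /M tr_diag_mx map_diag_mx; congr diag_mx.
  by apply/rowP => l; rewrite !mxE; exact: conj_realc.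
pose P := coef *m M *m coef^t*.
have PP : P *m P = P.
  rewrite /P; move: coef coef_gram => N NN.
  by rewrite !mulmxA -(mulmxA _ _ N) NN -(mulmxA N) -(mulmxA N) MM.
have Ph : P^t* = P by rewrite /P; move: coef => N; rewrite !adjM adjK Mh mulmxA.
have PE : P i i = (\sum_l coef_ratio i l)%:C.
  rewrite mxE rmorph_sum; apply: eq_bigr => l _.
  rewrite /M mul_mx_diag !mxE /coef_ratio rmorphM /= sqmodE.
  by rewrite [coef i l]mxE mulrAC.
have : (\sum_l coef_ratio i l) = \sum_l sqmod (P i l).
  apply: (@complexI R); rewrite -PE -{1}PP mxE rmorph_sum; apply: eq_bigr => l _.
  by rewrite -{2}Ph !mxE; symmetry; exact: sqmodE.
set q := \sum_l _ => qE.
have : q ^+ 2 <= q.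
  rewrite [leRHS]qE (bigD1 i) //= PE /sqmod /= expr0n addr0 lerDl.
  by rewrite sumr_ge0 // => l _; apply: sqmod_ge0.
have q0 : 0 <= q by rewrite sumr_ge0 // => l _; apply: coef_ratio_ge0.
move=> H; rewrite leNgt; apply/negP => q1.
have : q * 1 < q * q by rewrite ltr_pM2l //; lra.
by rewrite -expr2; lra.
Qed.

Hypothesis mu_down : forall i j, (i <= j < d)%N -> mu`_j <= mu`_i.
Variable a : k.-tuple R.
Hypothesis Ga : completion a G.

Lemma norm_ratio (i : 'I_k) : \sum_l coef_ratio i l * mu`_l = a`_i.
Proof. by rewrite -(coef_row _ Ga); apply: eq_bigr => l _; rewrite coef_ratioK. Qed.

Lemma psum_norm s : \sum_(i < s) a`_i =
  \sum_(i < k | (i < s)%N) \sum_(l < d) coef_ratio i l * mu`_l.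
Proof.
rewrite (@psum_widen _ a k) ?size_tuple //.
by apply: eq_bigr => i _; rewrite norm_ratio.
Qed.

Lemma frame_trace : vtr a = vtr mu.
Proof.
rewrite !vtrE; under eq_bigr do rewrite -(coef_row _ Ga).
by rewrite exchange_big; apply: eq_bigr => l _; rewrite coef_col.
Qed.

(** The inequality of Schur, for frames: squared norms are the image of the
    eigenvalues under a doubly substochastic array. *)
Lemma frame_majorization s : \sum_(i < s) a`_i <= \sum_(i < s) mu`_i.
Proof.
case: (leqP s d) => [sd|ds]; last first.
  rewrite [leRHS]psum_total ?size_tuple ?(ltnW ds) // -frame_trace.
  rewrite psum_norm vtrE [leRHS](bigID (fun i : 'I_k => (i < s)%N)) /=.
  under [X in _ <= X + _]eq_bigr do rewrite -norm_ratio.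
  rewrite lerDl sumr_ge0 // => i _; rewrite -norm_ratio sumr_ge0 // => l _.
  by rewrite mulr_ge0 ?coef_ratio_ge0 ?frame_eig_ge0.
case: s sd => [|s] sd; first by rewrite !big_ord0.
rewrite psum_norm; apply: substochastic_psum => //.
- exact: frame_eig_ge0.
- exact: coef_ratio_ge0.
- exact: coef_ratio_col.
- exact: coef_ratio_row.
Qed.

(** The equality case in the inequality of Schur: the first s vectors live in the
    span of the first s eigenvectors, and the others in the orthogonal of it. *)
Lemma tight_coef_eq0 s : (0 < s < d)%N -> mu`_s < mu`_s.-1 ->
  \sum_(i < s) a`_i = \sum_(i < s) mu`_i ->
  forall (i : 'I_k) (l : 'I_d), (i < s)%N != (l < s)%N -> coef i l = 0.
Proof.
move=> sd mus; rewrite psum_norm => E i l il; apply: sqmod_eq0.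
rewrite -coef_ratioK (substochastic_tight _ _ _ _ _ sd mus E il) ?mul0r //.
- exact: frame_eig_ge0.
- exact: coef_ratio_ge0.
- exact: coef_ratio_col.
- exact: coef_ratio_row.
Qed.

End Coefficients.
End Frames.

(** * Equality in the trace inequality for a pair of operators *)

Section Pair.
Local Open Scope sesquilinear_scope.
Local Open Scope complex_scope.
Variable R : realType.
Local Notation C := R[i].

Lemma nth_vadd n (x y : n.-tuple R) i : (vadd x y)`_i = x`_i + y`_i.
Proof.
case: (ltnP i n) => im; first by rewrite /vadd (nth_mktuple (fun i => x`_i + y`_i)).
by rewrite !nth_default ?size_tuple // addr0.
Qed.

Lemma nth_vsub n (x y : n.-tuple R) i : (vsub x y)`_i = x`_i - y`_i.
Proof.
case: (ltnP i n) => im; first by rewrite /vsub (nth_mktuple (fun i => x`_i - y`_i)).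
by rewrite !nth_default ?size_tuple // subr0.
Qed.

Lemma sort_down_eq n (x y : n.-tuple R) :
  sort_down x = sort_down y <-> perm_eq x y.
Proof.
have tot : total (>=%R : rel R) by move=> a b; exact: le_total.
have tr : transitive (>=%R : rel R) by move=> b a c ba cb; exact: le_trans cb ba.
have asym : antisymmetric (>=%R : rel R).
  by move=> a b /andP[ba ab]; apply: le_anti; apply/andP; split; [exact: ab|exact: ba].
split=> [/(congr1 val) E|/(perm_sortP tot tr asym) E]; last exact: val_inj.
exact/(perm_sortP tot tr asym).
Qed.

Lemma rank_diagC d (x : d.-tuple R) r : (r <= d)%N ->
  (forall i, (i < d)%N -> (i < r)%N = (x`_i != 0)) -> \rank (diagC x) = r.
Proof.
move=> rd xr.
pose D : 'M[C]_d := diag_mx (\row_i (if (i < r)%N then (x`_i)%:C else 1)).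
have Du : D \in unitmx.
  rewrite unitmxE det_diag unitfE; apply/prodf_neq0 => i _; rewrite mxE.
  case: ifP => ir; last exact: oner_neq0.
  by rewrite (inj_eq (@complexI R)) -xr.
have -> : diagC x = pid_mx r *m D.
  apply/matrixP => i j; rewrite /D mul_mx_diag !mxE.
  rewrite -[i == j]val_eqE /=; case: eqP => [/val_inj <-|_]; last by rewrite mul0r.
  case: ifP => ir; first by rewrite mulr1n mul1r.
  have := xr i (ltn_ord i); rewrite ir => /esym/negbFE/eqP ->.
  by rewrite mulr1n mul0r.
by rewrite mxrankMfree ?row_free_unit // rank_pid_mx.
Qed.

Variables (d n0 k : nat) (F0 : n0.-tuple 'rV[C]_d) (G : k.-tuple 'rV[C]_d).
Variables (U V : 'M[C]_d) (lam mu : d.-tuple R).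
Hypotheses (Uu : U \is unitarymx) (Vu : V \is unitarymx).
Hypothesis F0E : frame_op F0 = U^t* *m diagC lam *m U.
Hypothesis GE : frame_op G = V^t* *m diagC mu *m V.
Hypothesis lam_up : forall i j, (i <= j < d)%N -> lam`_i <= lam`_j.
Hypothesis mu_down : forall i j, (i <= j < d)%N -> mu`_j <= mu`_i.
Hypothesis optimal : eig_down (frame_op (F0 ++ G)) = sort_down (vadd lam mu).

Let S := frame_op (F0 ++ G).
Let W := U *m V^t*.

(** Compare the traces of the squares of S_F and of its two summands. *)
Lemma optimal_trace :
  \sum_(i < d) \sum_(j < d) lam`_i * mu`_j * sqmod (W i j) =
  \sum_(i < d) lam`_i * mu`_i.
Proof.
have SE : S = frame_op F0 + frame_op G by apply: frame_op_cat.
have Sh : S \is hermsymmx.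
  have := frame_op_herm F0; have := frame_op_herm G; rewrite !hermE => /eqP GG /eqP FF.
  by rewrite SE linearD /= map_mxD -GG -FF.
have Sp : perm_eq (vadd lam mu) (eig S).
  by rewrite perm_sym; apply/sort_down_eq; apply: optimal.
have [Z Zu SZ] := spectral_perm Sh Sp.
have : \tr (S *m S) = (\sum_(i < d) (lam`_i + mu`_i) ^+ 2)%:C.
  rewrite SZ trace_sq //; congr _%:C; apply: eq_bigr => i _.
  by rewrite nth_vadd.
have -> : \tr (S *m S) = \tr (frame_op F0 *m frame_op F0)
    + \tr (frame_op F0 *m frame_op G) *+ 2 + \tr (frame_op G *m frame_op G).
  rewrite SE mulmxDl !mulmxDr !mxtraceD (mxtrace_mulC (frame_op G) (frame_op F0)).
  by rewrite mulr2n !addrA.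
rewrite F0E GE !trace_sq // trace_mul -rmorphMn -!rmorphD => /(@complexI R).
under [in X in _ = X]eq_bigr do rewrite sqrrD.
rewrite !big_split /= => /addIr/addrI; rewrite -mulr2n.
exact: pmulrnI.
Qed.

Lemma optimal_matched i j : W i j != 0 -> matched lam mu i j.
Proof.
have Wu : W \is unitarymx := mul_unitarymx Uu (adj_unitary Vu).
move=> Wij; apply: (rearrangement_equality lam_up mu_down _ _ _ optimal_trace).
- by move=> a b; apply: sqmod_ge0.
- move=> a; apply: (@complexI R); have /unitarymxP/matrixP/(_ a a) := Wu.
  rewrite !mxE eqxx mulr1n rmorph_sum rmorph1 => <-; apply: eq_bigr => b _.
  by rewrite [(W^t*) b a]mxE [(W^T) b a]mxE; exact: sqmodE.
- move=> b; apply: (@complexI R); have /matrixP/(_ b b) := unitary_adjK Wu.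
  rewrite !mxE eqxx mulr1n rmorph_sum rmorph1 => <-; apply: eq_bigr => a _.
  by rewrite [(W^t*) b a]mxE [(W^T) b a]mxE mulrC; exact: sqmodE.
by apply: contra_neq Wij => /sqmod_eq0.
Qed.

Hypothesis plateau_lam : forall i j, (i < d)%N -> (j < d)%N ->
  0 < mu`_j -> mu`_i = mu`_j -> lam`_i = lam`_j.

(** A row of V has components only along the rows i of U for which the pair
    (lam_i, mu_j) already occurs on the diagonal, and on a plateau of mu inside
    the support lam is constant; so S_F0 acts on this row as a scalar. *)
Lemma row_eigen (j : 'I_d) : 0 < mu`_j ->
  row j V *m S = (lam`_j + mu`_j)%:C *: row j V.
Proof.
move=> mj.
have VA : row j V *m frame_op F0 = (lam`_j)%:C *: row j V.
  have VU : V = W^t* *m U by rewrite /W adjM adjK -mulmxA unitary_adjK // mulmx1.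
  rewrite F0E -row_mul {1}VU !mulmxA (mulmxtVK _ Uu) [in RHS]VU.
  rewrite !row_mul scalemxAl; congr (_ *m _).
  apply/rowP => i; rewrite /diagC mul_mx_diag !mxE mulrC.
  have [Wij|Wij] := eqVneq (W i j) 0.
    by move: Wij; rewrite mxE => ->; rewrite rmorph0 !mulr0.
  have [l ld [Ll Lm]] := optimal_matched Wij.
  by rewrite -Ll (plateau_lam ld _ mj Lm).
have VB : row j V *m frame_op G = (mu`_j)%:C *: row j V.
  rewrite GE -row_mul !mulmxA (unitarymxP Vu) mul1mx /diagC row_mul.
  by apply/rowP => i; rewrite row_diag_mx -scalemxAl -rowE !mxE.
by rewrite /S frame_op_cat mulmxDr VA VB -scalerDl -rmorphD.
Qed.

Variable r : nat.
Hypotheses (rd : (r <= d)%N).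
Hypothesis mu0 : forall i, 0 <= mu`_i.
Hypothesis mu_r : forall i, (i < d)%N -> (i < r)%N = (mu`_i != 0).

Lemma rank_frame_op : \rank (frame_op G) = r.
Proof.
rewrite GE mxrankMfree ?row_free_unit ?unitarymx_unit //.
have Vtu : V^t* \in unitmx := unitarymx_unit (adj_unitary Vu).
have Vf : row_full (V^t*) by rewrite row_full_unit.
by rewrite (eqmxMfull _ Vf) (rank_diagC rd mu_r).
Qed.

Let mu_gt0 i : (i < d)%N -> (i < r)%N -> 0 < mu`_i.
Proof. by move=> id ir; rewrite lt_neqAle mu0 eq_sym -mu_r // ir. Qed.

Let x := vadd lam mu.

Lemma diag_V_S : diagC mu *m V *m S = diagC mu *m diagC x *m V.
Proof.
apply/row_matrixP => j; rewrite -mulmxA !row_mul.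
have rd_ (y : d.-tuple R) : row j (diagC y) = (y`_j)%:C *: delta_mx 0 j.
  by rewrite /diagC row_diag_mx mxE.
rewrite rd_ -!scalemxAl -!rowE rd_ -!scalemxAl -rowE row_mul.
have [->|mn] := eqVneq mu`_j 0; first by rewrite !scale0r.
by rewrite row_eigen ?nth_vadd // lt_neqAle mu0 eq_sym mn.
Qed.

Lemma stable_frame_op : stablemx (frame_op G) S.
Proof.
rewrite GE.
suff -> : V^t* *m diagC mu *m V *m S =
    (V^t* *m diagC x *m V) *m (V^t* *m diagC mu *m V) by apply: submxMl.
rewrite -!(mulmxA (V^t*)) diag_V_S.
rewrite (_ : diagC mu *m diagC x = diagC x *m diagC mu); last exact: diag_mxC.
by rewrite !mulmxA (mulmxtVK _ Vu).
Qed.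

(** The rows of V with index below r form a basis of the range of S_G that
    diagonalizes the restriction. *)
Lemma restricted_eigenvalueP (z : C) :
  eigenvalue (restrictmx (frame_op G) S) z <->
  exists2 l, (l < r)%N & z = (x`_l)%:C.
Proof.
split.
  case/eigenvalueP => v vz v0.
  have : (v <= eigenspace (restrictmx (frame_op G) S) z)%MS by apply/eigenspaceP.
  rewrite sub_eigenspace_conjmx ?stablemx_row_base ?stable_frame_op ?row_base_free //.
  move=> /eigenspaceP wz.
  have : v *m row_base (frame_op G) != 0.
    by apply: contra_neq v0 => H; apply: (row_free_inj (row_base_free (frame_op G))); rewrite mul0mx.
  have : (v *m row_base (frame_op G) <= frame_op G)%MS by rewrite mulmx_sub ?eq_row_base.
  move: wz; set w := v *m _ => wz /submxP[u uE] w0.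
  pose y := w *m V^t*.
  have wy : w = y *m V by rewrite /y -mulmxA unitary_adjK // mulmx1.
  have yE : y = u *m V^t* *m diagC mu.
    by rewrite /y uE GE !mulmxA (mulmxtVK _ Vu).
  clearbody y.
  have yz : y *m diagC x = z *: y.
    have Vf : row_free V by rewrite row_free_unit unitarymx_unit.
    apply: (row_free_inj Vf); rewrite -scalemxAl -wy -wz wy yE.
    by rewrite -!(mulmxA (u *m V^t*)) diag_V_S.
  have /rV0Pn[l yl] : y != 0.
    by apply: contra_neq w0 => y0; rewrite wy y0 mul0mx.
  exists l.
    rewrite mu_r //; apply: contra_neq yl => ml.
    by rewrite yE /diagC mul_mx_diag !mxE ml mulr0.
  move/rowP/(_ l): yz; rewrite /diagC mul_mx_diag !mxE mulrC => yz.
  by apply: (mulIf yl); rewrite -yz.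
case=> l lr ->; have ld := leq_trans lr rd.
have ml := mu_gt0 ld lr.
have VS := @row_eigen (Ordinal ld) ml.
have VG : (row (Ordinal ld) V <= frame_op G)%MS.
  have -> : row (Ordinal ld) V = ((mu`_l)^-1%:C *: delta_mx 0 (Ordinal ld) *m V) *m frame_op G.
    rewrite GE !mulmxA (mulmxtVK _ Vu) -!scalemxAl -rowE /diagC row_diag_mx mxE.
    rewrite -scalemxAl -rowE scalerA -rmorphM /= mulVf ?lt0r_neq0 //.
    by rewrite rmorph1 scale1r.
  exact: submxMl.
have /submxP[q qE] : (row (Ordinal ld) V <= row_base (frame_op G))%MS by rewrite eq_row_base.
apply/eigenvalueP; exists q.
  apply/eigenspaceP; rewrite sub_eigenspace_conjmx ?stablemx_row_base ?stable_frame_op ?row_base_free //.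
  by apply/eigenspaceP; rewrite -qE VS nth_vadd.
apply/eqP => q0; move: qE; rewrite q0 mul0mx => /eqP; apply/negP.
have /row_unitarymxP/(_ (Ordinal ld) (Ordinal ld)) := Vu.
rewrite eqxx => E; apply/negP => /eqP H; move: E; rewrite H linear0l => /eqP.
by rewrite eq_sym oner_eq0.
Qed.

End Pair.

(** * Realizing the vectors of Gamma *)

Section Existence.
Local Open Scope sesquilinear_scope.
Local Open Scope complex_scope.
Variable R : realType.
Local Notation C := R[i].

Lemma adj_realc m n (T : 'M[R]_(m, n)) :
  (map_mx (real_complex R) T)^t* = map_mx (real_complex R) T^T.
Proof. by apply/matrixP => i j; rewrite !mxE; exact: conj_realc. Qed.

(** Start from the k x d matrix with the square roots of g on its diagonal, whose
    rows have squared norms g, give its rows the norms prescribed by a without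
    changing its Gram matrix, and express them in the basis U. *)
Lemma exists_frame d k (U : 'M[C]_d) (g : d.-tuple R) (a : k.-tuple R) :
  (d <= k)%N -> U \is unitarymx -> (forall i, 0 <= g`_i) ->
  (forall i j, (i <= j < k)%N -> a`_j <= a`_i) ->
  (forall m, \sum_(i < m) a`_i <= \sum_(i < m) g`_i) -> vtr a = vtr g ->
  exists2 G : k.-tuple 'rV[C]_d, completion a G &
    frame_op G = U^t* *m diagC g *m U.
Proof.
move=> dk Uu g0 a_down pre tot.
pose T0 : 'M[R]_(k, d) := \matrix_(i, j) (Num.sqrt g`_j *+ (i == j :> nat)).
have sqT0 (i : 'I_k) : sqnorm_row T0 i = g`_i.
  rewrite /sqnorm_row; case: (ltnP i d) => id.
    rewrite (bigD1 (Ordinal id)) //= big1 => [|j]; last first.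
      by rewrite -val_eqE /= eq_sym => /negbTE ij; rewrite mxE ij expr0n.
    by rewrite mxE eqxx mulr1n addr0 sqr_sqrtr.
  rewrite nth_default ?size_tuple // big1 // => j _; rewrite mxE.
  have jd := ltn_ord j; have -> : (i == j :> nat) = false by lia.
  by rewrite expr0n.
have GT0 : T0^T *m T0 = diag_mx (\row_i g`_i).
  apply/matrixP => i j; rewrite !mxE.
  rewrite (bigD1 (widen_ord dk i)) //= big1 ?addr0 => [|l]; last first.
    by rewrite -val_eqE /= => /negbTE li; rewrite !mxE li mul0r.
  rewrite !mxE /= eqxx mulr1n -[i == j]val_eqE /=.
  case: eqP => [ij|_]; last by rewrite mulr0.
  by rewrite -ij -expr2 sqr_sqrtr.
have psum_diff m : \sum_(i < k | (i < m)%N) (sqnorm_row T0 i - a`_i) =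
    \sum_(i < m) g`_i - \sum_(i < m) a`_i.
  rewrite sumrB (@psum_widen _ g k) ?size_tuple // (@psum_widen _ a k) ?size_tuple //.
  by congr (_ - _); apply: eq_bigr => i _.
have [|||T [TT sqT]] := @prescribe_row_norms _ k d T0 (fun i => a`_i).
- by move=> i j ij; apply: a_down; rewrite ij ltn_ord.
- by move=> m; rewrite psum_diff subr_ge0.
- have := psum_diff k; rewrite !psum_total ?size_tuple // -tot subrr => E; rewrite -[RHS]E.
  by apply: eq_bigl => i; rewrite ltn_ord.
pose Tc := map_mx (real_complex R) T.
have Gm : frame_mx [tuple row i (Tc *m U) | i < k] = Tc *m U.
  by apply/row_matrixP => i; rewrite row_frame_mx tnth_mktuple.
exists [tuple row i (Tc *m U) | i < k].
  move=> i; rewrite tnth_mktuple dotmxE row_mul adjM mulmxA mulmxtVK //.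
  rewrite -dotmxE dotmx_row -sqT /sqnorm_row; congr _%:C; apply: eq_bigr => l _.
  by rewrite mxE /sqmod /= expr0n addr0.
rewrite frame_opE Gm adjM !mulmxA -(mulmxA (U^t*)) /Tc adj_realc -map_mxM TT GT0.
rewrite map_diag_mx (_ : map_mx _ _ = \row_i (g`_i)%:C%C) //.
by apply/rowP => i; rewrite !mxE.
Qed.

(** Every g in Gamma comes from an optimal completion, built in an eigenbasis of
    S_F0, whose potential is the sum of f (lam_i + g_i). *)
Lemma op_min_is_mu_f d n0 k (f : R -> R) (F0 : n0.-tuple 'rV[C]_d)
    (a : k.-tuple R) (G : k.-tuple 'rV[C]_d) :
  (d <= k)%N -> sorted >=%R a -> (forall i, 0 <= a`_i) ->
  op_global_min f F0 a G ->
  is_mu_f f (eig_up (frame_op F0)) a (eig_down (frame_op G)).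
Proof.
move=> dk a_sorted a0 [[Ga opG] minG].
set lam := eig_up _; set mu := eig_down _.
have le_tot : total (>=%R : rel R) by move=> x y; exact: le_total.
have mu_sorted : sorted >=%R mu by apply: sort_sorted.
have mu_down := proj1 (sorted_geP _) mu_sorted; rewrite size_tuple in mu_down.
have [V Vu GE] : exists2 V : 'M[C]_d, V \is unitarymx &
    frame_op G = V^t* *m diagC mu *m V.
  by apply: spectral_perm (frame_op_herm G) _; rewrite perm_sort.
have [U Uu F0E] : exists2 U : 'M[C]_d, U \is unitarymx &
    frame_op F0 = U^t* *m diagC lam *m U.
  by apply: spectral_perm (frame_op_herm F0) _; rewrite perm_sort.
have potE G' g : eig_down (frame_op (F0 ++ G')) = sort_down (vadd lam g) ->
    potential f (F0 ++ G') = \sum_(i < d) f (lam`_i + g`_i).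
  move=> E; rewrite /potential E (perm_big _ (permEl (perm_sort _ _))).
  by rewrite big_tuple; apply: eq_bigr => i _; rewrite (tnth_nth 0) nth_vadd.
split.
  apply/(GammaE _ a_sorted a0); split=> //.
  - exact: frame_eig_ge0 Vu GE.
  - exact: frame_majorization Vu GE mu_down _ Ga.
  - exact: frame_trace Vu GE _ Ga.
move=> g Gg; have [g0 g_down pre tot] := proj1 (GammaE _ a_sorted a0) Gg.
have a_down := proj1 (sorted_geP _) a_sorted; rewrite size_tuple in a_down.
have [G' G'a G'E] := exists_frame dk Uu g0 a_down pre tot.
have g_sorted : sorted >=%R g by apply/sorted_geP; rewrite size_tuple.
have eigG' : eig_down (frame_op G') = g.
  have /sort_down_eq : perm_eq (eig (frame_op G')) g by rewrite G'E eig_conj_diag.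
  rewrite /eig_down => ->; apply: val_inj; apply: sorted_sort => //.
  by move=> y x z yx zy; exact: le_trans zy yx.
have eigS : eig_down (frame_op (F0 ++ G')) = sort_down (vadd lam g).
  apply/sort_down_eq; rewrite frame_op_cat F0E G'E -mulmxDl -mulmxDr.
  have -> : diagC lam + diagC g = diagC (vadd lam g).
    rewrite /diagC -linearD; congr diag_mx; apply/rowP => i.
    by rewrite !mxE nth_vadd rmorphD.
  exact: eig_conj_diag.
rewrite -(potE _ _ opG) -(potE _ _ eigS); apply: minG; split=> //.
by rewrite eigG'.
Qed.
End Existence.

(** * Structure of global minimizers *)

Section Assembly.
Variable R : realType.

Lemma sum_nat_diff (F : nat -> R) m n : (m <= n)%N ->
  \sum_(m <= i < n) F i = \sum_(i < n) F i - \sum_(i < m) F i.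
Proof.
move=> mn; rewrite -!(big_mkord xpredT) (@big_cat_nat _ _ _ m 0 n) //=.
by rewrite addrC addrK.
Qed.

Lemma psum_drop (x : seq R) q j :
  \sum_(i < j) (drop q x)`_i = \sum_(i < q + j) x`_i - \sum_(i < q) x`_i.
Proof.
rewrite big_split_ord /= addrC addrK.
by apply: eq_bigr => i _; rewrite nth_drop.
Qed.

Lemma flatten_blocks (y c : seq R) (s : nat -> nat) n :
  s 0%N = 0%N -> (forall j, (j < n)%N -> (s j <= s j.+1)%N) -> (s n <= size y)%N ->
  (forall j i, (j < n)%N -> (s j <= i < s j.+1)%N -> y`_i = c`_j) ->
  flatten [seq nseq (s j.+1 - s j) c`_j | j <- iota 0 n] = take (s n) y.
Proof.
move=> s0; elim: n => [|n IH] smono sy yc; first by rewrite s0 take0.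
have sn : (s n <= s n.+1)%N by apply: smono.
rewrite -addn1 iotaD map_cat flatten_cat IH; first last.
- by move=> j i jn; apply: yc; apply: leqW.
- exact: leq_trans sn sy.
- by move=> j jn; apply: smono; apply: leqW.
rewrite add0n /= cats0 addn1 -[in RHS](subnKC sn) takeD; congr (_ ++ _).
apply: (@eq_from_nth _ 0).
  by rewrite size_nseq size_takel // size_drop leq_sub2r.
move=> i; rewrite size_nseq => isn; rewrite nth_nseq isn nth_take // nth_drop.
apply/esym/yc => //; by rewrite leq_addr -ltn_subRL.
Qed.

Section Truncation.
Variables (d k q r : nat) (c : R) (lam mu : d.-tuple R) (a : k.-tuple R).
Hypothesis mu_zero : forall i, (r <= i)%N -> mu`_i = 0.

Lemma psum_support l : (r <= l)%N -> \sum_(i < l) mu`_i = vtr mu.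
Proof.
move=> rl; rewrite -(@psum_total R mu (l + d)) ?size_tuple ?leq_addl //.
rewrite big_split_ord /= [X in _ + X]big1 ?addr0 // => i _.
by apply: mu_zero; apply: leq_trans rl (leq_addr _ _).
Qed.

Hypotheses (qr : (q < r)%N) (rd : (r <= d)%N) (dk : (d <= k)%N).
Hypothesis same_trace : vtr a = vtr mu.
Hypothesis tight : \sum_(i < q) a`_i = \sum_(i < q) mu`_i.
Hypothesis level : forall i, (q <= i < r)%N -> lam`_i + mu`_i = c.

(** Beyond q, the vectors a and mu have the same total. *)
Lemma level_const_mul :
  (r - q)%:R * c = \sum_(q <= i < k) a`_i + \sum_(q <= i < r) lam`_i.
Proof.
have qk : (q <= k)%N by lia.
have -> : \sum_(q <= i < k) a`_i = \sum_(q <= i < r) mu`_i.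
  by rewrite !sum_nat_diff ?(ltnW qr) // tight (psum_support (leqnn r)) -same_trace vtrE.
rewrite addrC -big_split /= mulr_natl -sumr_const_nat.
by apply: eq_big_nat => i qir; rewrite level.
Qed.

Hypothesis lam_up : forall i j, (i <= j < d)%N -> lam`_i <= lam`_j.
Hypothesis above : forall i, (r <= i < d)%N -> c <= lam`_i.
Hypothesis mu_ge0 : forall i, 0 <= mu`_i.

Let lam' := [tuple of drop q lam].
Let a' := [tuple of drop q a].

Let lam'E i : lam'`_i = lam`_(q + i). Proof. by rewrite nth_drop. Qed.
Let a'E i : a'`_i = a`_(q + i). Proof. by rewrite nth_drop. Qed.

Let truncated_trace : vtr a' = \sum_(q <= i < k) a`_i.
Proof.
have qk : (q <= k)%N by lia.
by rewrite vtrE psum_drop subnKC // sum_nat_diff.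
Qed.

Lemma truncated_nth i : (i < d - q)%N ->
  (nu lam' a')`_i = lam`_(q + i) + mu`_(q + i).
Proof.
move=> id; have qrE : (q + (r - q) = r)%N by rewrite subnKC // ltnW.
have levelE j : (j < r - q)%N -> lam`_(q + j) + mu`_(q + j) = c.
  by move=> jr; apply: level; lia.
have wl : water_level lam' a' (r - q) c.
  split.
  - by lia.
  - by move=> j jr; rewrite lam'E -(levelE j jr) lerDl.
  - by move=> j rj; rewrite lam'E; apply: above; lia.
  rewrite level_const_mul truncated_trace psum_drop qrE; congr (_ + _).
  by rewrite sum_nat_diff // ltnW.
have lam'_up j l : (j <= l < d - q)%N -> lam'`_j <= lam'`_l.
  by move=> jl; rewrite !lam'E; apply: lam_up; lia.
rewrite (nu_fill_level lam'_up wl) /fill_level.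
rewrite (nth_mktuple (fun i => if (i < r - q)%N then c else lam'`_i)) //.
case: ltnP => ir; first by rewrite levelE.
by rewrite lam'E mu_zero ?addr0 //; lia.
Qed.

Lemma truncated_nuE : nu lam' a' = nseq (r - q) c ++ drop r lam :> seq R.
Proof.
apply: (@eq_from_nth _ 0).
  by rewrite size_cat size_nseq size_drop !size_tuple; lia.
move=> i; rewrite size_tuple => id; rewrite truncated_nth // nth_cat size_nseq.
case: ltnP => ir; first by rewrite nth_nseq ir level //; lia.
rewrite nth_drop mu_zero ?addr0; last by lia.
by congr (lam`_ _); lia.
Qed.

Hypothesis mu_down : forall i j, (i <= j < d)%N -> mu`_j <= mu`_i.
Hypotheses (a_sorted : sorted >=%R a) (a_ge0 : forall i, 0 <= a`_i).
Hypothesis dominated : forall j, \sum_(i < j) a`_i <= \sum_(i < j) mu`_i.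

Lemma truncated_feasible : feasible lam' a'.
Proof.
have resE i : (vsub (nu lam' a') lam')`_i = mu`_(q + i).
  case: (ltnP i (d - q)) => id.
    by rewrite nth_vsub truncated_nth // lam'E addrC addKr.
  by rewrite nth_default ?size_tuple // nth_default // size_tuple; lia.
have res_psum j : \sum_(i < j) (vsub (nu lam' a') lam')`_i =
    \sum_(i < q + j) mu`_i - \sum_(i < q) mu`_i.
  by rewrite -psum_drop; apply: eq_bigr => i _; rewrite resE nth_drop.
apply/majorized_sortedP.
- apply/sorted_geP; rewrite size_tuple => i j ij; rewrite !a'E.
  by have := proj1 (sorted_geP _) a_sorted; rewrite size_tuple; apply; lia.
- apply/sorted_geP; rewrite size_tuple => i j ij; rewrite !resE.
  by apply: mu_down; lia.
- by move=> i; rewrite a'E.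
- by move=> i; rewrite resE.
split=> [j|]; first by rewrite psum_drop res_psum tight // lerB.
rewrite truncated_trace [RHS]vtrE res_psum sum_nat_diff; last by lia.
rewrite subnKC; last by lia.
by rewrite -!vtrE same_trace tight.
Qed.

End Truncation.

Section MinimizerBlocks.
Variables (d k r : nat) (f : R -> R) (lam mu : d.-tuple R) (a : k.-tuple R).
Hypotheses (cf : strictly_convex_on_nneg f) (d_gt0 : (0 < d)%N) (dk : (d <= k)%N).
Hypothesis lam_ge0 : forall i, 0 <= lam`_i.
Hypothesis lam_up : forall i j, (i <= j < d)%N -> lam`_i <= lam`_j.
Hypotheses (a_sorted : sorted >=%R a) (a_pos : forall i : 'I_k, 0 < a`_i).
Hypothesis min_mu : is_mu_f f lam a mu.
Hypothesis rE : forall i, (i < r)%N = (i < d)%N && (mu`_i != 0).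

Let a_ge0 : forall i, 0 <= a`_i.
Proof. by apply: nth_ge0 => i; apply: ltW. Qed.

Let mu_ge0 : forall i, 0 <= mu`_i.
Proof. by have [] := proj1 (GammaE mu a_sorted a_ge0) (proj1 min_mu). Qed.

Let same_trace : vtr a = vtr mu.
Proof. by have [] := proj1 (GammaE mu a_sorted a_ge0) (proj1 min_mu). Qed.

Let rd : (r <= d)%N.
Proof. by rewrite leqNgt rE ltnn. Qed.

Let mu_zero i : (r <= i)%N -> mu`_i = 0.
Proof.
case: (ltnP i d) => id; last by rewrite nth_default // size_tuple.
by rewrite leqNgt rE id negbK => /eqP.
Qed.

Let psum_lt l : (l < k)%N -> \sum_(i < l) a`_i < vtr a.
Proof.
move=> lk; rewrite vtrE (big_ord_widen _ (fun i => a`_i) (ltnW lk)).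
rewrite [ltRHS](bigID (fun i : 'I_k => (i < l)%N)) /= ltrDl.
rewrite (bigD1 (Ordinal lk)) /= ?ltnn // ltr_wpDr ?(a_pos (Ordinal lk)) //.
by rewrite sumr_ge0.
Qed.

Lemma support_gt0 : (0 < r)%N.
Proof.
rewrite lt0n; apply/eqP => r0; have := psum_lt (leq_trans d_gt0 dk).
by rewrite same_trace vtrE big_ord0 big1 ?ltxx // => i _; rewrite mu_zero // r0.
Qed.

(** If lam_i were below the level at the end of the support, some prefix sum of
    mu beyond the support, that is the whole trace, would equal a proper prefix
    sum of the positive vector a. *)
Lemma support_tail i : (r <= i < d)%N -> lam`_r.-1 + mu`_r.-1 <= lam`_i.
Proof.
move=> /andP[ri id]; rewrite leNgt; apply/negP => lc; have r0 := support_gt0.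
have [||l ll E] := minimizer_tight cf lam_ge0 lam_up a_sorted a_ge0 min_mu
  (i := r.-1) (j := i).
- by rewrite id andbT; lia.
- by rewrite [mu`_i]mu_zero // addr0.
have lk : (l < k)%N by lia.
by have := psum_lt lk; rewrite E (psum_support mu_zero) ?same_trace ?ltxx //; lia.
Qed.

Variables (p : nat) (c : p.-tuple R).
Hypothesis c_sorted : sorted >%R c.
Hypothesis xc : forall i, (i < r)%N -> lam`_i + mu`_i \in (c : seq R).
Hypothesis cx : forall j, (j < p)%N -> exists2 i, (i < r)%N & lam`_i + mu`_i = c`_j.

(** A drop of lam + mu between adjacent indexes leaves a single prefix length for
    the active constraint of [minimizer_tight].  There mu drops too, since lam
    increases. *)
Lemma minimizer_blocks : (0 < p)%N /\ exists s : nat -> nat,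
  [/\ s 0%N = 0%N, forall j, (j < p)%N -> (s j < s j.+1)%N, s p = r &
      forall j i, (j < p)%N ->
        (s j <= i < s j.+1)%N = (i < r)%N && (lam`_i + mu`_i == c`_j)] /\
  forall j, (j < p)%N -> \sum_(i < s j) a`_i = \sum_(i < s j) mu`_i /\
    ((0 < j)%N -> (0 < s j < d)%N /\ mu`_(s j) < mu`_(s j).-1).
Proof.
have x_down i j : (i <= j < r)%N -> lam`_j + mu`_j <= lam`_i + mu`_i.
  move=> /andP[]; rewrite leq_eqVlt => /orP[/eqP-> //|ij jr].
  apply: minimizer_mono cf lam_ge0 lam_up a_sorted a_ge0 min_mu _ _ _ _.
    by rewrite ij (leq_trans jr rd).
  by move: jr; rewrite rE => /andP[_ mj]; rewrite lt_neqAle eq_sym mj mu_ge0.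
have [s [s0 sS sp blockE]] := level_blocks c_sorted x_down xc cx.
have p_gt0 : (0 < p)%N.
  have /(nthP 0)[l] := xc support_gt0.
  by rewrite size_tuple => /(leq_ltn_trans (leq0n _)).
split=> //; exists s; split=> // j jp.
case: (posnP j) => [->|j0]; first by rewrite s0 !big_ord0.
have s_mono i l : (i <= l <= p)%N -> (s i <= s l)%N.
  elim: l => [|l IH] /andP[]; first by rewrite leqn0 => /eqP->.
  rewrite leq_eqVlt => /orP[/eqP-> //|]; rewrite ltnS => il lp.
  by apply: leq_trans (IH _) (ltnW (sS _ lp)); rewrite il ltnW.
have sj : (s j.-1 < s j < r)%N.
  have := sS j.-1; rewrite prednK // => -> /=; last by lia.
  by rewrite -sp; apply: leq_trans (sS _ jp) (s_mono _ _ _); rewrite jp leqnn.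
have sjd : (s j < d)%N by lia.
have xs : lam`_(s j) + mu`_(s j) = c`_j.
  by have := blockE j (s j) jp; rewrite leqnn sS // => /esym/andP[_ /eqP].
have xs' : lam`_(s j).-1 + mu`_(s j).-1 = c`_j.-1.
  have jE : j.-1.+1 = j by lia.
  have : (s j.-1 <= (s j).-1 < s j.-1.+1)%N by rewrite jE; lia.
  by rewrite blockE => [/andP[_ /eqP]|]; last by lia.
have drop_j : lam`_(s j) + mu`_(s j) < lam`_(s j).-1 + mu`_(s j).-1.
  by rewrite xs xs' (sorted_gt_nth c_sorted) // size_tuple; lia.
split=> [|_].
  have [|l ll E] := minimizer_tight cf lam_ge0 lam_up a_sorted a_ge0 min_mu
    (i := (s j).-1) (j := s j) _ drop_j; first by lia.
  by have <- : l = s j by lia.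
split; first by lia.
have := lam_up (i := (s j).-1) (j := s j); rewrite sjd leq_pred => /(_ isT); lra.
Qed.
End MinimizerBlocks.

End Assembly.

Theorem theorem4p4 (R : realType) (d n0 k : nat)
    (F0 : n0.-tuple 'rV[R[i]]_d) (a : k.-tuple R)
    (f : R -> R) (G : k.-tuple 'rV[R[i]]_d) (p : nat) (c : p.-tuple R)
    (d_gt0 : (0 < d)%N) (d_le_k : (d <= k)%N)
    (data : initial_data F0 a)
    (f_ge0 : nonneg_on_nneg f)
    (f_convex : strictly_convex_on_nneg f)
    (minG : op_global_min f F0 a G)
    (specW : restricted_spectrum F0 G c) :
  let lam := eig_up (frame_op F0) in
  let mu := eig_down (frame_op G) in
  let K := fun j : nat => Kset lam mu G c`_j in
  let J := fun j : nat => Jset F0 G c`_j in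
  exists s : nat -> nat,
    (* 1 *)
    ([/\ s 0%N = 0%N,
         forall j : nat, (j < p)%N -> (s j < s j.+1)%N,
         s p = \rank (frame_op G),
         s p = \max_(i < d | mu`_i != 0) i.+1
       & [/\ forall j : nat, (j.+1 < p)%N ->
               K j = [set i : 'I_d | (s j <= i < s j.+1)%N] /\
               J j = [set i : 'I_k | (s j <= i < s j.+1)%N],
             K p.-1 = [set i : 'I_d | (s p.-1 <= i < s p)%N]
           & J p.-1 = [set i : 'I_k | (s p.-1 <= i)%N]]]
     (* 2 *)
     /\ [/\ nu_f f lam a =
              flatten [seq nseq (s j.+1 - s j) c`_j | j <- iota 0 p]
                ++ drop (s p) lam :> seq R,
            forall r : nat, (r.+1 < p)%N ->
              c`_r = (s r.+1 - s r)%:R^-1 *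
                       \sum_(s r <= i < s r.+1) (lam`_i + a`_i)
          & forall r : nat, (r.+1 < p)%N ->
              forall i : 'I_d, i \in K r -> c`_r = lam`_i + mu`_i]
     (* 3 *)
     /\ (let lam' := [tuple of drop (s p.-1) lam] in
         let a' := [tuple of drop (s p.-1) a] in
         [/\ c`_p.-1 = (s p - s p.-1)%:R^-1 *
                         (\sum_(s p.-1 <= i < k) a`_i +
                          \sum_(s p.-1 <= i < s p) lam`_i),
             feasible lam' a'
           & nu lam' a' =
               nseq (s p - s p.-1) c`_p.-1 ++ drop (s p) lam :> seq R])).
Proof.
move=> lam mu K J; case: data => a_pos a_sorted _.
have a0 : forall i, 0 <= a`_i by apply: nth_ge0 => i; apply: ltW.
have mu_min := op_min_is_mu_f d_le_k a_sorted a0 minG.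
rewrite -/lam -/mu in mu_min.
have [[Ga opG] _] := minG.
have [V Vu GE] : exists2 V : 'M[R[i]]_d, V \is unitarymx &
    frame_op G = (V^t* *m diagC mu *m V)%sesqui.
  by apply: spectral_perm (frame_op_herm G) _; rewrite perm_sort.
have [U Uu F0E] : exists2 U : 'M[R[i]]_d, U \is unitarymx &
    frame_op F0 = (U^t* *m diagC lam *m U)%sesqui.
  by apply: spectral_perm (frame_op_herm F0) _; rewrite perm_sort.
have lam_sorted : sorted <=%R lam by apply: sort_sorted; apply: le_total.
have lam_up := proj1 (sorted_leP _) lam_sorted; rewrite size_tuple in lam_up.
have [mu0 mu_down mu_pre mu_tr] := proj1 (GammaE _ a_sorted a0) (proj1 mu_min).
have lam0 : forall i, 0 <= lam`_i := frame_eig_ge0 Uu F0E.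
have mono := minimizer_mono f_convex lam0 lam_up a_sorted a0 mu_min.
have nuE : nu_f f lam a = vadd lam mu by rewrite /nu_f (mu_fE f_convex lam0 a_sorted a0 mu_min).
rewrite -/lam -/mu in opG.
move: @K @J; clearbody lam mu => K J.
(* The support of mu is an initial segment, because mu decreases. *)
have [r rE] : exists r, forall i, (i < r)%N = (i < d)%N && (mu`_i != 0).
  apply: initial_segment => i j ij; apply: contra_neq => mi0.
  by apply/eqP; rewrite eq_le mu0 andbT -[leRHS]mi0 mu_down.
have rd : (r <= d)%N by rewrite leqNgt rE ltnn.
have mu_r i : (i < d)%N -> (i < r)%N = (mu`_i != 0) by rewrite rE => ->.
have rank_r := rank_frame_op Vu GE rd mu_r.
have mu_pos i : (i < r)%N -> 0 < mu`_i.
  by rewrite rE => /andP[_ mi]; rewrite lt_neqAle eq_sym mi mu0.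
have mu_zero i : (r <= i)%N -> mu`_i = 0.
  move=> ri; case: (ltnP i d) => id; last by rewrite nth_default // size_tuple.
  by move: ri; rewrite leqNgt mu_r // negbK => /eqP.
pose x := vadd lam mu.
have xE i : x`_i = lam`_i + mu`_i by apply: nth_vadd.
(* On a plateau of mu, lam is both non-decreasing and non-increasing. *)
have plateau_lam i j : (i < d)%N -> (j < d)%N -> 0 < mu`_j -> mu`_i = mu`_j ->
    lam`_i = lam`_j.
  move=> id jd mj mij; apply/eqP; rewrite eq_le; case: (ltngtP i j) => [ij|ji|->]; last first.
  - by rewrite lexx.
  - have := mono j i; rewrite ji id mij => /(_ isT mj).
    by rewrite lerD2r => ->; rewrite lam_up // ltnW.
  - have := mono i j; rewrite ij jd mij => /(_ isT mj).
    by rewrite lerD2r => ->; rewrite lam_up ?andbT // ltnW.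
have eigenP := restricted_eigenvalueP Uu Vu F0E GE lam_up mu_down opG plateau_lam rd mu0 mu_r.
have eigenV := row_eigen Uu Vu F0E GE lam_up mu_down opG plateau_lam.
rewrite -/x in eigenP.
case: specW => c_sorted specW.
have xc i : (i < r)%N -> lam`_i + mu`_i \in (c : seq R).
  move=> ir; have /specW[y yc /(@complexI R) ->] // :
    eigenvalue (restrictmx (frame_op G) (frame_op (F0 ++ G))) (lam`_i + mu`_i)%:C%C.
  by apply/eigenP; exists i; rewrite ?xE.
have cx j : (j < p)%N -> exists2 i, (i < r)%N & lam`_i + mu`_i = c`_j.
  move=> jp; have cj : c`_j \in (c : seq R) by rewrite mem_nth // size_tuple.
  have /eigenP[i ir /(@complexI R) ->] :
      eigenvalue (restrictmx (frame_op G) (frame_op (F0 ++ G))) (c`_j)%:C%C.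
    by apply/specW; exists c`_j.
  by exists i; rewrite ?xE.
have [p_gt0 [s [[s0 sS sp blockE] boundary]]] := minimizer_blocks
  f_convex d_gt0 d_le_k lam0 lam_up a_sorted a_pos mu_min rE c_sorted xc cx.
have tight j : (j < p)%N -> \sum_(i < s j) a`_i = \sum_(i < s j) mu`_i.
  by move=> /boundary[].
have coef0 j (i : 'I_k) (l : 'I_d) : (j < p)%N -> (i < s j)%N != (l < s j)%N ->
    coef G V i l = 0.
  move=> jp il; case: (posnP j) => [j0|j0]; first by rewrite j0 s0 in il.
  have [_ /(_ j0)[sj mu_drop]] := boundary j jp.
  exact: (tight_coef_eq0 Vu GE mu_down Ga sj mu_drop (tight j jp) il).
have xs j i : (j < p)%N -> (s j <= i < s j.+1)%N -> lam`_i + mu`_i = c`_j.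
  by move=> jp; rewrite blockE // => /andP[_ /eqP].
(* The last block of vectors is unbounded: it absorbs all g_i beyond s p. *)
pose bl j (i : nat) := (s j <= i)%N && ((j.+1 < p)%N ==> (i < s j.+1)%N).
have blP i : exists2 j, (j < p)%N & bl j i := last_block_index i p_gt0 s0.
(* A vector of block j has components only along eigenvectors of level c_j. *)
have bl_coef j (i : 'I_k) (l : 'I_d) : (j < p)%N -> bl j i -> coef G V i l != 0 ->
    (l < r)%N /\ lam`_l + mu`_l = c`_j.
  move=> jp /andP[sji /implyP ij] cn.
  have lr : (l < r)%N.
    by rewrite mu_r //; apply: contra_neq cn => ml; apply: coef_eq0 Vu GE _ _ ml.
  split=> //; apply: xs => //; apply/andP; split.
    rewrite leqNgt; apply: contra_neqN cn => ls; apply: (coef0 j) => //.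
    by rewrite ls ltnNge sji.
  case: (ltnP j.+1 p) => jp'; last first.
    have -> : j.+1 = p by lia.
    by rewrite sp.
  rewrite ltnNge; apply: contra_neqN cn => ls; apply: (coef0 j.+1) => //.
  by rewrite (ij jp') ltnNge ls.
have gE (i : 'I_k) : tnth G i = \sum_l coef G V i l *: row l V.
  rewrite -row_frame_mx (frame_mx_coef G Vu) row_mul mulmx_sum_row.
  by apply: eq_bigr => l _; rewrite [row i _ 0 l]mxE.
have g_eigen j (i : 'I_k) : (j < p)%N -> bl j i ->
    tnth G i *m frame_op (F0 ++ G) = (c`_j)%:C%C *: tnth G i.
  move=> jp ij; rewrite gE mulmx_suml scaler_sumr; apply: eq_bigr => l _.
  have [->|cn] := eqVneq (coef G V i l) 0; first by rewrite !scale0r mul0mx scaler0.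
  have [lr xl] := bl_coef j i l jp ij cn.
  by rewrite -scalemxAl eigenV ?mu_pos // xl !scalerA mulrC.
have c_inj i j : (i < p)%N -> (j < p)%N -> c`_i = c`_j -> i = j.
  have c_down := sorted_gt_nth c_sorted; rewrite size_tuple in c_down.
  move=> ip jp cij; case: (ltngtP i j) => // [ij|ji].
    by have := c_down i j; rewrite ij jp cij ltxx => /(_ isT).
  by have := c_down j i; rewrite ji ip cij ltxx => /(_ isT).
have JE j : (j < p)%N -> J j = [set i : 'I_k | bl j i].
  move=> jp; apply/setP => i; rewrite !inE; apply/eqP/idP; last exact: g_eigen.
  have [l lp il] := blP i; rewrite (g_eigen l i lp il) => E.
  have gn : tnth G i != 0.
    apply: contraTneq (a_pos i) => g0; rewrite -leNgt.
    have := Ga i; rewrite g0 linear0l => /(@complexI R) <-; exact: lexx.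
  move: E => /eqP; rewrite -subr_eq0 -scalerBl scaler_eq0 (negbTE gn) orbF subr_eq0.
  by move=> /eqP/(@complexI R)/(c_inj _ _ lp jp) <-.
have KE j : (j < p)%N -> K j = [set i : 'I_d | (s j <= i < s j.+1)%N].
  move=> jp; apply/setP => i; rewrite !inE blockE //.
  by rewrite /Kset rank_r.
have p1 : (p.-1 < p)%N by rewrite prednK.
have p1S : p.-1.+1 = p by rewrite prednK.
have block_sum j : (j < p)%N ->
    (s j.+1 - s j)%:R * c`_j = \sum_(s j <= i < s j.+1) (lam`_i + mu`_i).
  move=> jp; rewrite mulr_natl -sumr_const_nat; apply: eq_big_nat => i ij.
  by rewrite (xs j i jp ij).
have block_pos j : (j < p)%N -> (s j.+1 - s j)%:R != 0 :> R.
  by move=> jp; rewrite pnatr_eq0 subn_eq0 -ltnNge sS.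
have qr : (s p.-1 < r)%N by have := sS _ p1; rewrite p1S sp.
have tail i : (r <= i < d)%N -> c`_p.-1 <= lam`_i.
  move=> ri; rewrite -(xs p.-1 r.-1) //; last by rewrite p1S sp; lia.
  exact: (support_tail f_convex d_gt0 d_le_k lam0 lam_up a_sorted a_pos mu_min rE).
exists s; split; [|split].
- split=> //; first by rewrite rank_r.
    rewrite sp; apply/eqP; rewrite eqn_leq; apply/andP; split; last first.
      by apply/bigmax_leqP => i mi; rewrite mu_r.
    have r1d : (r.-1 < d)%N by lia.
    have r_gt0 : (0 < r)%N by lia.
    have := @leq_bigmax_cond _ (fun i : 'I_d => mu`_i != 0) (fun i => i.+1) (Ordinal r1d).
    by rewrite /= prednK //; apply; rewrite -mu_r // prednK.
  split=> [j jp||].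
  - have jp' := ltn_trans (ltnSn j) jp.
    split; first exact: KE.
    by rewrite JE //; apply/setP => i; rewrite !inE /bl jp.
  - by rewrite KE // p1S.
  - by rewrite JE //; apply/setP => i; rewrite !inE /bl p1S ltnn andbT.
- split.
  + rewrite nuE (@flatten_blocks _ x) //; last by move=> j i jp ij; rewrite xE; apply: xs.
    * rewrite -/x -[in LHS](cat_take_drop (s p) x); congr (_ ++ _).
      apply: (@eq_from_nth _ 0); first by rewrite !size_drop !size_tuple.
      move=> i _; rewrite !nth_drop xE mu_zero ?addr0 // sp; exact: leq_addr.
    * by move=> j jp; apply/ltnW/sS.
    * by rewrite size_tuple sp.
  + move=> j jp; have jp' := ltn_trans (ltnSn j) jp.
    apply: (mulfI (block_pos _ jp')); rewrite block_sum // mulrA divff ?block_pos // mul1r.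
    rewrite !big_split /=; congr (_ + _).
    by rewrite !sum_nat_diff ?tight // ltnW // sS.
  + move=> j jp i; have jp' := ltn_trans (ltnSn j) jp.
    by rewrite KE // inE => /(xs _ _ jp') <-.
have last_level i : (s p.-1 <= i < r)%N -> lam`_i + mu`_i = c`_p.-1.
  by move=> qir; apply: xs => //; rewrite p1S sp.
move=> lam' a'; rewrite sp; split.
- have N : (r - s p.-1)%:R != 0 :> R by have := block_pos _ p1; rewrite p1S sp.
  apply: (mulfI N); rewrite mulrA divff // mul1r.
  exact: (level_const_mul mu_zero qr rd d_le_k mu_tr (tight _ p1) last_level).
- exact: (truncated_feasible mu_zero qr rd d_le_k mu_tr (tight _ p1) last_level
    lam_up tail mu0 mu_down a_sorted a0 mu_pre).
- exact: (truncated_nuE mu_zero qr rd d_le_k mu_tr (tight _ p1) last_level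
    lam_up tail mu0).
Qed.
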